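(* Assume (A1)–(A3) hold. Fix a time step $\Delta t>0$, an index $n\ge1$ and previous-step values $(\xi_h^{n-1},p_h^{n-1},T_h^{n-1})\in Q_h\times W_h\times W_h$. Let $(\mathbf u_h^n,\xi_h^n,p_h^n,T_h^n)\in\mathbf V_h\times Q_h\times W_h\times W_h$ be the solution of the coupled problem: for all $(\mathbf v_h,\phi_h,q_h,S_h)\in\mathbf V_h\times Q_h\times W_h\times W_h$, $$2\mu(\boldsymbol\varepsilon(\mathbf u_h^n),\boldsymbol\varepsilon(\mathbf v_h))-(\nabla\cdot\mathbf v_h,\xi_h^n)=(\mathbf f,\mathbf v_h),$$ $$-(\nabla\cdot\mathbf u_h^n,\phi_h)-\tfrac1\lambda(\xi_h^n,\phi_h)+\tfrac\alpha\lambda(p_h^n,\phi_h)+\tfrac\beta\lambda(T_h^n,\phi_h)=0,$$ $$-\tfrac\alpha\lambda(\xi_h^n,q_h)+(c_0+\tfrac{\alpha^2}\lambda)(p_h^n,q_h)+(\tfrac{\alpha\beta}\lambda-b_0)(T_h^n,q_h)+\Delta t(\mathbf K\nabla p_h^n,\nabla q_h)=(c_0+\tfrac{\alpha^2}\lambda)(p_h^{n-1},q_h)+(\tfrac{\alpha\beta}\lambda-b_0)(T_h^{n-1},q_h)-\tfrac\alpha\lambda(\xi_h^{n-1},q_h)+\Delta t(g,q_h),$$ $$-\tfrac\beta\lambda(\xi_h^n,S_h)+(a_0+\tfrac{\beta^2}\lambda)(T_h^n,S_h)+(\tfrac{\alpha\beta}\lambda-b_0)(p_h^n,S_h)+\Delta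 t(\boldsymbol\Theta\nabla T_h^n,\nabla S_h)=(a_0+\tfrac{\beta^2}\lambda)(T_h^{n-1},S_h)+(\tfrac{\alpha\beta}\lambda-b_0)(p_h^{n-1},S_h)-\tfrac\beta\lambda(\xi_h^{n-1},S_h)+\Delta t(H_s,S_h).$$ Define iterates by $\xi_h^{n,0}=\xi_h^{n-1}$, $p_h^{n,0}=p_h^{n-1}$, $T_h^{n,0}=T_h^{n-1}$ and, for $i\ge1$: Step 1: find $(p_h^{n,i},T_h^{n,i})\in W_h\times W_h$ such that for all $(q_h,S_h)\in W_h\times W_h$ $$(c_0+\tfrac{\alpha^2}\lambda)(p_h^{n,i},q_h)+(\tfrac{\alpha\beta}\lambda-b_0)(T_h^{n,i},q_h)+\Delta t(\mathbf K\nabla p_h^{n,i},\nabla q_h)=\Delta t(g,q_h)+(c_0+\tfrac{\alpha^2}\lambda)(p_h^{n-1},q_h)+(\tfrac{\alpha\beta}\lambda-b_0)(T_h^{n-1},q_h)+\tfrac\alpha\lambda(\xi_h^{n,i-1},q_h)-\tfrac\alpha\lambda(\xi_h^{n-1},q_h),$$ $$(a_0+\tfrac{\beta^2}\lambda)(T_h^{n,i},S_h)+(\tfrac{\alpha\beta}\lambda-b_0)(p_h^{n,i},S_h)+\Delta t(\boldsymbol\Theta\nabla T_h^{n,i},\nabla S_h)=\Delta t(H_s,S_h)+(a_0+\tfrac{\beta^2}\lambda)(T_h^{n-1},S_h)+(\tfrac{\alpha\beta}\lambda-b_0)(p_h^{n-1},S_h)+\tfrac\beta\lambda(\xi_h^{n,i-1},S_h)-\tfrac\beta\lambda(\xi_h^{n-1},S_h);$$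 Step 2: find $(\mathbf u_h^{n,i},\xi_h^{n,i})\in\mathbf V_h\times Q_h$ such that for all $(\mathbf v_h,\phi_h)\in\mathbf V_h\times Q_h$ $$2\mu(\boldsymbol\varepsilon(\mathbf u_h^{n,i}),\boldsymbol\varepsilon(\mathbf v_h))-(\nabla\cdot\mathbf v_h,\xi_h^{n,i})=(\mathbf f,\mathbf v_h),\qquad(\nabla\cdot\mathbf u_h^{n,i},\phi_h)+\tfrac1\lambda(\xi_h^{n,i},\phi_h)=\tfrac\alpha\lambda(p_h^{n,i},\phi_h)+\tfrac\beta\lambda(T_h^{n,i},\phi_h).$$ Then the sequence $\{(\mathbf u_h^{n,i},\xi_h^{n,i},p_h^{n,i},T_h^{n,i})\}_{i=1}^\infty$ converges to $(\mathbf u_h^n,\xi_h^n,p_h^n,T_h^n)$ as $i\to\infty$.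
   Context: Let $\Omega\subset\mathbb R^2$ be a bounded polygonal domain with boundary $\partial\Omega=\Gamma_d\cup\Gamma_n$, $\Gamma_d\neq\partial\Omega$. $(\cdot,\cdot)$ is the $L^2(\Omega)$ inner product, $\boldsymbol\varepsilon(\mathbf u)=\frac12(\nabla\mathbf u+\nabla\mathbf u^T)$. Assumptions: (A1) $\mathbf K,\boldsymbol\Theta$ are $2\times2$ matrix fields, constant in time, symmetric positive definite, with constants $k_m,k_M,\theta_m,\theta_M>0$ such that $k_m|\mathbf v|^2\le\mathbf v^T\mathbf K(x)\mathbf v$, $|\mathbf K(x)\mathbf v|\le k_M|\mathbf v|$, $\theta_m|\mathbf v|^2\le\mathbf v^T\boldsymbol\Theta(x)\mathbf v$, $|\boldsymbol\Theta(x)\mathbf v|\le\theta_M|\mathbf v|$ for all nonzero $\mathbf v$; (A2) $\lambda,\mu,\alpha,\beta>0$ constants; (A3) constants $a_0,c_0\ge b_0\ge0$. Data $\mathbf f\in L^2(\Omega)^2$, $g,H_s\in L^2(\Omega)$. Let $\mathcal T_h$ be a shape-regular, quasi-uniform triangulation of $\Omega$ with mesh size $h$. Finite element spaces: $\mathbf V_h=\{\mathbf v_h\in C^0(\bar\Omega)^2:\mathbf v_h|_K\in\mathbb P_2(K)^2\ \forall K\in\mathcal T_h,\ \mathbf v_h=0\text{ on }\Gamma_d\}$; $Q_h=\{\phi_h\in C^0(\bar\Omega):\phi_h|_K\in\mathbb P_1(K)\ \forall K\}$; $W_h=\{q_h\in C^0(\bar\Omega):q_h|_K\in\mathbb P_1(K)\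 \forall K,\ q_h=0\text{ on }\partial\Omega\}$ (Taylor–Hood pair $\mathbf V_h\times Q_h$, assumed to satisfy the uniform discrete inf-sup condition $\inf_{\xi\in Q_h}\sup_{\mathbf v\in\mathbf V_h}\frac{(\nabla\cdot\mathbf v,\xi)}{\|\mathbf v\|_{H^1}\|\xi\|_{L^2}}\ge\gamma>0$ with $\gamma$ independent of $h$).
   Formalization: The formal theorem additionally assumes that Γ_d contains a nondegenerate segment; for Γ_d = ∅, allowed by the context, rigid motions lie in V_h, the solution is not unique and the iterates u_h^{n,i} need not converge. *)

(* Defs.v *)
From HB Require Import structures.
From mathcomp Require Import all_boot all_order all_algebra.
From mathcomp Require Import all_classical all_reals all_analysis.
Set Implicit Arguments. Unset Strict Implicit. Unset Printing Implicit Defensive.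
Import Order.TTheory GRing.Theory Num.Theory.
Import numFieldNormedType.Exports.
Local Open Scope classical_set_scope.
Local Open Scope ring_scope.

Section FEDefs.
Variable R : realType.
Local Notation pt := (R * R)%type.

Definition leb2 := ((@lebesgue_measure R) \x (@lebesgue_measure R))%E.
(** the measurable type on which leb2 lives (Borel/product sigma-algebra) *)
Definition mR := g_sigma_algebraType (R.-ocitv.-measurable).
Definition mpt := (mR * mR)%type.
Definition meas_on (O : set pt) (f : pt -> R) : Prop :=
  @measurable_fun _ _ mpt R O f.

Definition L2ip (O : set pt) (f g : pt -> R) : R :=
  Rintegral leb2 O (fun x => f x * g x).
Definition L2norm (O : set pt) (f : pt -> R) : R := Num.sqrt (L2ip O f f).

Definition inL2 (O : set pt) (f : pt -> R) : Prop :=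
  meas_on O f /\ leb2.-integrable O (fun x => (f x ^+ 2)%:E).

Definition e_ (j : 'I_2) : pt := if j == ord0 then (1, 0) else (0, 1).
Definition partial (j : 'I_2) (f : pt -> R) (x : pt) : R := derive f x (e_ j).

Definition vcomp (i : 'I_2) (u : pt -> pt) (x : pt) : R :=
  if i == ord0 then (u x).1 else (u x).2.
Definition vsub (u v : pt -> pt) : pt -> pt :=
  fun x => ((u x).1 - (v x).1, (u x).2 - (v x).2).

Definition strain (u : pt -> pt) (i j : 'I_2) (x : pt) : R :=
  (partial j (vcomp i u) x + partial i (vcomp j u) x) / 2.
Definition divv (u : pt -> pt) (x : pt) : R :=
  \sum_(i < 2) partial i (vcomp i u) x.

Definition strain_ip (O : set pt) (u v : pt -> pt) : R :=
  Rintegral leb2 O (fun x => \sum_(i < 2) \sum_(j < 2) strain u i j x * strain v i j x).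
Definition vL2ip (O : set pt) (u v : pt -> pt) : R :=
  Rintegral leb2 O (fun x => \sum_(i < 2) vcomp i u x * vcomp i v x).
Definition Kgrad_ip (O : set pt) (K : pt -> 'M[R]_2) (p q : pt -> R) : R :=
  Rintegral leb2 O (fun x =>
    \sum_(i < 2) (\sum_(j < 2) K x i j * partial j p x) * partial i q x).

Definition H1norm (O : set pt) (f : pt -> R) : R :=
  Num.sqrt (L2ip O f f + \sum_(j < 2) L2ip O (partial j f) (partial j f)).
Definition vH1norm (O : set pt) (u : pt -> pt) : R :=
  Num.sqrt (\sum_(i < 2) H1norm O (vcomp i u) ^+ 2).

Definition tri := 'I_3 -> pt.
Definition ctri (T : tri) : set pt :=
  [set x | exists l : 'I_3 -> R, (forall k, 0 <= l k) /\ \sum_(k < 3) l k = 1 /\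
     x.1 = \sum_(k < 3) l k * (T k).1 /\ x.2 = \sum_(k < 3) l k * (T k).2].
Definition nondegenerate (T : tri) : Prop :=
  ((T 1%R).1 - (T 0%R).1) * ((T 2%R).2 - (T 0%R).2)
  - ((T 1%R).2 - (T 0%R).2) * ((T 2%R).1 - (T 0%R).1) != 0.
Definition seg (a b : pt) : set pt :=
  [set x | exists t : R, 0 <= t <= 1 /\
     x = ((1 - t) * a.1 + t * b.1, (1 - t) * a.2 + t * b.2)].
Definition bdry (O : set pt) : set pt := closure O `\` O.

Definition conforming (T T' : tri) : Prop :=
  ctri T `&` ctri T' = set0 \/
  (exists k l, T k = T' l /\ ctri T `&` ctri T' = [set T k]) \/
  (exists k k' l l', k != k' /\ T k = T' l /\ T k' = T' l' /\
                     ctri T `&` ctri T' = seg (T k) (T k')).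

Definition triangulation (O : set pt) (N : nat) (mesh : 'I_N -> tri) : Prop :=
  (forall k, nondegenerate (mesh k)) /\
  closure O = \bigcup_(k in [set: 'I_N]) ctri (mesh k) /\
  (forall k l, k != l -> conforming (mesh k) (mesh l)).

Definition poly_on (deg : nat) (T : tri) (v : pt -> R) : Prop :=
  exists c : nat -> nat -> R, forall x, ctri T x ->
    v x = \sum_(a < deg.+1) \sum_(b < deg.+1 | (a + b <= deg)%N)
            c a b * x.1 ^+ a * x.2 ^+ b.

Definition cpw (deg : nat) (O : set pt) (N : nat) (mesh : 'I_N -> tri)
    (v : pt -> R) : Prop :=
  {within closure O, continuous v} /\ forall k, poly_on deg (mesh k) v.

Definition Vh (O Gd : set pt) N (mesh : 'I_N -> tri) (v : pt -> pt) : Prop :=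
  (forall i, cpw 2 O mesh (vcomp i v)) /\ (forall x, Gd x -> forall i, vcomp i v x = 0).
Definition Qh (O : set pt) N (mesh : 'I_N -> tri) (phi : pt -> R) : Prop :=
  cpw 1 O mesh phi.
Definition Wh (O : set pt) N (mesh : 'I_N -> tri) (q : pt -> R) : Prop :=
  cpw 1 O mesh q /\ (forall x, bdry O x -> q x = 0).

Definition spd_field (O : set pt) (K : pt -> 'M[R]_2) (km kM : R) : Prop :=
  0 < km /\ 0 < kM /\
  (forall i j, meas_on O (fun x => K x i j)) /\
  forall x, O x ->
    (K x)^T = K x /\
    forall v : 'I_2 -> R, (exists i, v i != 0) ->
      km * \sum_(i < 2) v i ^+ 2 <= \sum_(i < 2) \sum_(j < 2) v i * K x i j * v j /\
      Num.sqrt (\sum_(i < 2) (\sum_(j < 2) K x i j * v j) ^+ 2)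
        <= kM * Num.sqrt (\sum_(i < 2) v i ^+ 2).

End FEDefs.

(* Main.v *)
Require Import Defs.
From HB Require Import structures.
From mathcomp Require Import all_boot all_order all_algebra.
From mathcomp Require Import all_classical all_reals all_analysis.
From mathcomp Require Import measurable_realfun ring lra.
Set Implicit Arguments. Unset Strict Implicit. Unset Printing Implicit Defensive.
Import Order.TTheory GRing.Theory Num.Theory.
Import numFieldNormedType.Exports.
Local Open Scope classical_set_scope.
Local Open Scope ring_scope.

(** Write X, P, Q, W for the errors in xi, p, T, u, and Z = alpha P + beta Q.
    Testing Step 1 with the errors gives |Z|^2 + lam dt (K-energy of P + Th-energy
    of Q) <= (X_old, Z), and Step 2 gives |X_new|^2 + 2 mu lam |strain W|^2 =
    (Z, X_new). By Young's inequality |X|^2 is nonincreasing and its decrements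
    dominate the strain and diffusion energies, which therefore tend to 0.  A
    discrete Korn inequality turns this into convergence of W, P and Q in H^1, and
    |X_new| <= |Z| then gives convergence of X; the inf-sup condition only affects
    the rate.

    Korn's inequality is proved along a sequence w_i of finite element fields with
    strain energy tending to 0.  On each triangle the strain is affine, so smallness
    in L^2 of a small box forces its coefficients to 0, and w_i is asymptotically an
    infinitesimal rigid motion, which tends to 0 as soon as it does so at two points.
    A triangle sharing two points with the clamped segment starts the argument, and
    connectedness of the domain propagates it from triangle to triangle.

    The domain is only open, so its boundary may have positive measure and the
    partial derivatives are junk on the mesh edges.  Every integral is therefore
    reduced to the core, the part of the domain inside open triangles, where all
    integrands are bounded and measurable. *)

(** * Measure theory in the plane *)

Section null_sets.
Import HBNNSimple.

(** The integral of a nonnegative function is a supremum over the simple functions below it, and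
    cutting such a simple function off on [N] leaves its integral unchanged. Arguing at this level
    covers arbitrary integrands, among them derivatives that are junk on mesh edges. *)
Lemma integral_setD_null d (T : measurableType d) (R : realType)
    (mu : {measure set T -> \bar R}) (D N : set T) (f : T -> \bar R) :
  measurable N -> mu N = 0%E ->
  (\int[mu]_(x in D) f x = \int[mu]_(x in D `\` N) f x)%E.
Proof.
move=> mN muN0.
wlog f0 : f / forall x, (0 <= f x)%E.
  by move=> H; rewrite integralE [in RHS]integralE !H.
apply/eqP; rewrite eq_le; apply/andP; split; last first.
  rewrite integral_mkcond [leRHS]integral_mkcond !ge0_integralTE; first last.
  - by move=> x; apply: erestrict_ge0.
  - by move=> x; apply: erestrict_ge0.
  apply: le_ereal_sup => _ /= [h hf <-]; exists h => // x.
  apply: (le_trans (hf x)).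
  rewrite /patch; case: ifPn => [|_]; last by case: ifP.
  by rewrite in_setD => /andP[-> _].
rewrite integral_mkcond [leRHS]integral_mkcond !ge0_integralTE; first last.
- by move=> x; apply: erestrict_ge0.
- by move=> x; apply: erestrict_ge0.
apply: ge_ereal_sup => _ /= [h hf <-].
pose k := proj_nnsfun h (measurableC mN).
have -> : sintegral mu h = sintegral mu k.
  have -> : sintegral mu h = (\int[mu]_x (h x)%:E)%E.
    by rewrite integral_nnsfun// patch_setT.
  have -> : sintegral mu k = (\int[mu]_(x in ~` N) (h x)%:E)%E.
    by rewrite integral_nnsfun -?mrestrict//; exact: measurableC.
  rewrite (ge0_negligible_integral mN)//; last by move=> x _; rewrite lee_fin.
    by rewrite setTD.
  by apply/measurable_EFinP.
apply: ereal_sup_ubound; exists k => // x.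
have -> : k x = (h \_ (~` N)) x by rewrite (mrestrict h (measurableC mN)).
move: (hf x); rewrite /patch in_setD in_setC.
case: (x \in N) => /=; first by rewrite andbF.
by rewrite andbT.
Qed.

End null_sets.

Section plane.
Variable R : realType.
Local Notation pt := (R * R)%type.
Local Notation mpt := (mpt R).

(** Measurability refers to the product sigma-algebra, so the open set is written as a countable
    union of rectangles: [F q] is the open square of rational centre [q.1] and radius [q.2] if [A]
    contains it, and is empty otherwise. *)
Lemma open_measurable_plane (A : set pt) : open A -> @measurable _ mpt A.
Proof.
move=> oA.
pose F (q : rat * rat * rat) : set pt :=
  [set x | [/\ `|x.1 - ratr q.1.1| < ratr q.2, `|x.2 - ratr q.1.2| < ratr q.2 &
    forall y : pt, `|y.1 - ratr q.1.1| < ratr q.2 ->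
      `|y.2 - ratr q.1.2| < ratr q.2 -> A y]].
have -> : A = \bigcup_q F q.
  apply/seteqP; split => [x Ax|x [q _ [? ? H]]]; last exact: H.
  have : nbhs x A by apply: open_nbhs_nbhs.
  rewrite -nbhs_ballE => -[e /= e0 xeA].
  (* A radius between [e / 4] and [e / 2] with a centre closer than [e / 4] to [x] gives a square
     that contains [x] and stays within distance [e] of it. *)
  have e4 : 0 < e / 4 by rewrite divr_gt0.
  have [r] : exists r : rat, e / 4 < ratr r < e / 2.
    have /rat_in_itvoo[r] : e / 4 < e / 2 by lra.
    by rewrite in_itv/=; exists r.
  move=> /andP[er re].
  have /rat_in_itvoo[a] : x.1 < x.1 + e / 4 by lra.
  rewrite in_itv/= => /andP[a1 a2].
  have /rat_in_itvoo[b] : x.2 < x.2 + e / 4 by lra.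
  rewrite in_itv/= => /andP[b1 b2].
  exists (a, b, r) => //; split => /=; rewrite ?ltr_norml.
  - by apply/andP; split; lra.
  - by apply/andP; split; lra.
  move=> y; rewrite !ltr_norml => /andP[y1 y2] /andP[y3 y4].
  apply: xeA; split; rewrite /= /ball/= ltr_norml; apply/andP; split; lra.
apply: countable_bigcupT_measurable; first exact: countableP.
move=> q.
have [H|H] := pselect (forall y : pt, `|y.1 - ratr q.1.1| < ratr q.2 ->
      `|y.2 - ratr q.1.2| < ratr q.2 -> A y); last first.
  have -> : F q = set0 by apply/seteqP; split => // x [].
  exact: measurable0.
have -> : F q = [set x : R | `|x - ratr q.1.1| < ratr q.2] `*`
   [set x : R | `|x - ratr q.1.2| < ratr q.2].
  by apply/seteqP; split => x [].
have mB (c r : R) : @measurable _ (mR R) [set x : R | `|x - c| < r].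
  have -> : [set x : R | `|x - c| < r] = `]c - r, c + r[%classic.
    apply/seteqP; split => x /=; rewrite in_itv/= ltr_norml => /andP[? ?];
      by apply/andP; split; lra.
  exact: measurable_itv.
by apply: measurableX.
Qed.

Lemma measurable_fst_plane (D : set mpt) : measurable_fun D (fun x : mpt => x.1 : R).
Proof. exact: measurable_funS measurable_fst. Qed.
Lemma measurable_snd_plane (D : set mpt) : measurable_fun D (fun x : mpt => x.2 : R).
Proof. exact: measurable_funS measurable_snd. Qed.

Lemma measurable_affine (a b c : R) (D : set mpt) :
  measurable_fun D (fun x : mpt => a * x.1 + b * x.2 + c).
Proof.
apply: measurable_funD => //; apply: measurable_funD; apply: measurable_funM => //.
exact: measurable_fst_plane.
exact: measurable_snd_plane.
Qed.

(** A vertical line is the product of a singleton with the real line; any other line meets each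
    vertical section in one point. *)
Lemma leb2_line0 (a b c : R) : (a != 0) || (b != 0) ->
  @measurable _ mpt [set x : mpt | a * x.1 + b * x.2 + c = 0] /\
  leb2 [set x : mpt | a * x.1 + b * x.2 + c = 0] = 0%E.
Proof.
move=> ab.
have mL : @measurable _ mpt [set x : mpt | a * x.1 + b * x.2 + c = 0].
  rewrite -[X in measurable X]setTI.
  have := @measurable_affine a b c setT measurableT [set 0] (measurable_set1 _).
  by [].
split => //.
have [b0|b0] := eqVneq b 0.
  rewrite b0 eqxx orbF in ab.
  have -> : [set x : mpt | a * x.1 + b * x.2 + c = 0] =
     [set (- c / a : R)] `*` setT.
    apply/seteqP; split => x /=; rewrite b0 mul0r addr0.
      move=> H; split => //; apply: (mulfI ab); rewrite mulrCA divff// mulr1.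
      by apply/eqP; rewrite -subr_eq0 opprK H.
    by case=> -> _; rewrite mulrCA divff// mulr1 addNr.
  rewrite [LHS]product_measure1E//=.
  by rewrite lebesgue_measure_set1 mul0e.
rewrite /leb2 /product_measure1 integral0_eq// => x _ /=.
have -> : xsection [set x : mpt | a * x.1 + b * x.2 + c = 0] x =
   [set (- (a * x + c) / b : R)].
  apply/seteqP; split => y /=; rewrite /xsection/= in_setE/=.
    move=> H; apply: (mulfI b0); rewrite mulrCA divff// mulr1; lra.
  by move=> ->; rewrite mulrCA divff// mulr1; lra.
by rewrite lebesgue_measure_set1.
Qed.

Lemma leb2_box (a b c d : R) : a <= b -> c <= d ->
  leb2 (`[a, b]%classic `*` `[c, d]%classic) = ((b - a) * (d - c))%:E.
Proof.
have H (x y : R) : x <= y -> lebesgue_measure `[x, y]%classic = (y - x)%:E.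
  rewrite le_eqVlt => /predU1P[->|xy]; first by rewrite set_itv1 lebesgue_measure_set1 subrr.
  by rewrite lebesgue_measure_itv/= lte_fin xy EFinB.
by move=> ab cd; rewrite [LHS]product_measure1E//= !H.
Qed.

End plane.

(** * Triangles *)

Section triangles.
Variable R : realType.
Local Notation pt := (R * R)%type.

Definition tdet (T : tri R) : R :=
  ((T 1%R).1 - (T 0%R).1) * ((T 2%R).2 - (T 0%R).2)
  - ((T 1%R).2 - (T 0%R).2) * ((T 2%R).1 - (T 0%R).1).
(** Barycentric coordinates of the vertices 1 and 2 by Cramer's rule, [tdet] being twice the signed
    area; the coordinate of vertex 0 is [1 - bary1 T x - bary2 T x]. *)
Definition bary1 (T : tri R) (x : pt) : R :=
  ((x.1 - (T 0%R).1) * ((T 2%R).2 - (T 0%R).2)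
  - (x.2 - (T 0%R).2) * ((T 2%R).1 - (T 0%R).1)) / tdet T.
Definition bary2 (T : tri R) (x : pt) : R :=
  (((T 1%R).1 - (T 0%R).1) * (x.2 - (T 0%R).2)
  - ((T 1%R).2 - (T 0%R).2) * (x.1 - (T 0%R).1)) / tdet T.
Definition tint (T : tri R) : set pt :=
  [set x | [/\ 0 < bary1 T x, 0 < bary2 T x & bary1 T x + bary2 T x < 1]].

Lemma ord3E : (lift ord0 ord0 = 1%R :> 'I_3) * (lift ord0 (lift ord0 ord0) = 2%R :> 'I_3)
  * (ord0 = 0%R :> 'I_3).
Proof. by split; [split|]; apply: val_inj. Qed.

Lemma big_ord3 (F : 'I_3 -> R) : \sum_(k < 3) F k = F 0%R + F 1%R + F 2%R.
Proof. by rewrite !big_ord_recl big_ord0 !ord3E addr0 addrA. Qed.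

(** Uniqueness of barycentric coordinates turns the existential weights of [ctri] into explicit
    affine inequalities. *)
Lemma ctriE (T : tri R) : Defs.nondegenerate T -> ctri T =
  [set x | [/\ 0 <= bary1 T x, 0 <= bary2 T x & bary1 T x + bary2 T x <= 1]].
Proof.
rewrite /Defs.nondegenerate -/(tdet T) => D0; apply/seteqP; split => x.
  case=> l [l0 []]; rewrite !big_ord3 => l1 [x1 x2].
  have e1 : bary1 T x = l 1%R.
    rewrite /bary1 x1 x2; apply: (mulIf D0); rewrite mulfVK//.
    have -> : l 0%R = 1 - l 1%R - l 2%R by rewrite -l1; ring.
    rewrite /tdet; ring.
  have e2 : bary2 T x = l 2%R.
    rewrite /bary2 x1 x2; apply: (mulIf D0); rewrite mulfVK//.
    have -> : l 0%R = 1 - l 1%R - l 2%R by rewrite -l1; ring.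
    rewrite /tdet; ring.
  by split; rewrite ?e1 ?e2//; have := l0 0%R; lra.
case=> h1 h2 h3.
pose l (k : 'I_3) : R := if k == 0%R then 1 - bary1 T x - bary2 T x else
  if k == 1%R then bary1 T x else bary2 T x.
exists l; rewrite !big_ord3 /l/=; split.
  by move=> k; case: ifP => _; [lra|case: ifP].
split; first by ring.
by rewrite /bary1 /bary2; split; move: D0; rewrite /tdet => D0; field.
Qed.

Lemma continuous_fst_plane : continuous (fun x : pt => x.1).
Proof. by move=> x; exact: cvg_fst. Qed.
Lemma continuous_snd_plane : continuous (fun x : pt => x.2).
Proof. by move=> x; exact: cvg_snd. Qed.

Lemma continuous_affine (a b c : R) : continuous (fun x : pt => a * x.1 + b * x.2 + c).
Proof.
move=> x; apply: cvgD; last exact: cvg_cst.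
by apply: cvgD; apply: cvgM; [exact: cvg_cst|exact: continuous_fst_plane|
  exact: cvg_cst|exact: continuous_snd_plane].
Qed.

(** The nonzero linear part makes the zero set a genuine line, so that the edges of the triangle are
    null sets. *)
Lemma bary1_affine (T : tri R) : Defs.nondegenerate T -> exists a b c : R, [/\ (a != 0) || (b != 0)
  & forall x, bary1 T x = a * x.1 + b * x.2 + c].
Proof.
rewrite /Defs.nondegenerate -/(tdet T) => D0.
exists (((T 2%R).2 - (T 0%R).2) / tdet T), (- ((T 2%R).1 - (T 0%R).1) / tdet T),
 ((- (T 0%R).1 * ((T 2%R).2 - (T 0%R).2)
  + (T 0%R).2 * ((T 2%R).1 - (T 0%R).1)) / tdet T); split.
  rewrite -negb_and; apply/negP; rewrite !mulf_eq0 !invr_eq0 ?oppr_eq0 (negbTE D0) !orbF => /andP[/eqP H1 /eqP H2].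
  by move/eqP: D0; apply; rewrite /tdet H1 H2 !mulr0 subr0.
move=> x; rewrite /bary1; field => //.
Qed.

Lemma bary2_affine (T : tri R) : Defs.nondegenerate T -> exists a b c : R, [/\ (a != 0) || (b != 0)
  & forall x, bary2 T x = a * x.1 + b * x.2 + c].
Proof.
rewrite /Defs.nondegenerate -/(tdet T) => D0.
exists (- ((T 1%R).2 - (T 0%R).2) / tdet T), (((T 1%R).1 - (T 0%R).1) / tdet T),
 ((- (T 0%R).2 * ((T 1%R).1 - (T 0%R).1)
  + (T 0%R).1 * ((T 1%R).2 - (T 0%R).2)) / tdet T); split.
  rewrite -negb_and; apply/negP; rewrite !mulf_eq0 !invr_eq0 ?oppr_eq0 (negbTE D0) !orbF => /andP[/eqP H1 /eqP H2].
  by move/eqP: D0; apply; rewrite /tdet H1 H2 !mul0r subr0.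
move=> x; rewrite /bary2; field => //.
Qed.

Lemma bary12_affine (T : tri R) : Defs.nondegenerate T -> exists a b c : R, [/\ (a != 0) || (b != 0)
  & forall x, bary1 T x + bary2 T x - 1 = a * x.1 + b * x.2 + c].
Proof.
rewrite /Defs.nondegenerate -/(tdet T) => D0.
exists (((T 2%R).2 - (T 1%R).2) / tdet T), (- ((T 2%R).1 - (T 1%R).1) / tdet T),
 ((- (T 0%R).1 * ((T 2%R).2 - (T 0%R).2)
  + (T 0%R).2 * ((T 2%R).1 - (T 0%R).1)
  - (T 0%R).2 * ((T 1%R).1 - (T 0%R).1)
  + (T 0%R).1 * ((T 1%R).2 - (T 0%R).2)) / tdet T - 1); split.
  rewrite -negb_and; apply/negP; rewrite !mulf_eq0 !invr_eq0 ?oppr_eq0 (negbTE D0) !orbF => /andP[/eqP H1 /eqP H2].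
  have : (T 2%R).2 = (T 1%R).2 by apply/eqP; rewrite -subr_eq0 H1.
  have : (T 2%R).1 = (T 1%R).1 by apply/eqP; rewrite -subr_eq0 H2.
  by move=> e1 e2; move/eqP: D0; apply; rewrite /tdet e1 e2; ring.
move=> x; rewrite /bary1 /bary2; field => //.
Qed.

Lemma continuous_bary1 (T : tri R) : Defs.nondegenerate T -> continuous (bary1 T).
Proof.
by case/bary1_affine => a [b [c [_ /funext ->]]]; exact: continuous_affine.
Qed.
Lemma continuous_bary2 (T : tri R) : Defs.nondegenerate T -> continuous (bary2 T).
Proof.
by case/bary2_affine => a [b [c [_ /funext ->]]]; exact: continuous_affine.
Qed.

Lemma open_tint (T : tri R) : Defs.nondegenerate T -> open (tint T).
Proof.
move=> nT; have c1 := continuous_bary1 nT; have c2 := continuous_bary2 nT.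
have -> : tint T = (bary1 T @^-1` [set y | 0 < y]) `&` (bary2 T @^-1` [set y | 0 < y])
    `&` ((fun x => bary1 T x + bary2 T x) @^-1` [set y | y < 1]).
  by apply/seteqP; split => x [] => [|[]].
apply: openI; first apply: openI.
- by apply: open_comp; [move=> x _; exact: c1|exact: open_gt].
- by apply: open_comp; [move=> x _; exact: c2|exact: open_gt].
- by apply: open_comp; [move=> x _; apply: cvgD; [exact: c1|exact: c2]|exact: open_lt].
Qed.

Lemma closed_ctri (T : tri R) : Defs.nondegenerate T -> closed (ctri T).
Proof.
move=> nT; have c1 := continuous_bary1 nT; have c2 := continuous_bary2 nT.
have -> : ctri T = (bary1 T @^-1` [set y | 0 <= y]) `&` (bary2 T @^-1` [set y | 0 <= y])
    `&` ((fun x => bary1 T x + bary2 T x) @^-1` [set y | y <= 1]).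
  by rewrite ctriE//; apply/seteqP; split => x [] => [|[]].
apply: closedI; first apply: closedI.
- by apply: closed_comp; [move=> x _; exact: c1|exact: closed_ge].
- by apply: closed_comp; [move=> x _; exact: c2|exact: closed_ge].
- by apply: closed_comp; [move=> x _; apply: cvgD; [exact: c1|exact: c2]|exact: closed_le].
Qed.

Lemma tint_ctri (T : tri R) : Defs.nondegenerate T -> tint T `<=` ctri T.
Proof. by move=> nT x []; rewrite ctriE// => *; split; lra. Qed.

Lemma ctri_vertex (T : tri R) k : ctri T (T k).
Proof.
exists (fun i => (i == k)%:R); split; first by move=> i; rewrite ler0n.
split; first by rewrite (bigD1 k)//= eqxx big1 ?addr0// => i /negbTE ->.
by split; rewrite (bigD1 k)//= eqxx mul1r big1 ?addr0// => i /negbTE ->; rewrite mul0r.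
Qed.

Lemma vertex_inj (T : tri R) : Defs.nondegenerate T -> injective T.
Proof.
rewrite /Defs.nondegenerate -/(tdet T) => D0.
have H01 : T 0%R != T 1%R.
  by apply/eqP => e; move/eqP: D0; apply; rewrite /tdet e; ring.
have H02 : T 0%R != T 2%R.
  by apply/eqP => e; move/eqP: D0; apply; rewrite /tdet e; ring.
have H12 : T 1%R != T 2%R.
  by apply/eqP => e; move/eqP: D0; apply; rewrite /tdet e; ring.
have E (k : 'I_3) : [\/ k = 0%R, k = 1%R | k = 2%R].
  case: k => [] [|[|[|//]]] ?; [apply: Or31|apply: Or32|apply: Or33]; exact: val_inj.
move=> i j; case: (E i) => ->; case: (E j) => ->// /eqP;
  by rewrite ?(negbTE H01) ?(negbTE H02) ?(negbTE H12)// eq_sym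
     ?(negbTE H01) ?(negbTE H02) ?(negbTE H12).
Qed.

(** No nonempty open set lies inside a line: from a zero, a shift by [e / 2] along an axis with
    nonzero coefficient changes the value. *)
Lemma nonzero_affine_open (a b c : R) (U : set pt) : (a != 0) || (b != 0) ->
  open U -> U !=set0 -> exists2 y, U y & a * y.1 + b * y.2 + c != 0.
Proof.
move=> ab oU [y Uy].
have [h|h] := eqVneq (a * y.1 + b * y.2 + c) 0; last by exists y.
have : nbhs y U by apply: open_nbhs_nbhs.
rewrite -nbhs_ballE => -[e /= e0 yeU].
case/orP: ab => ab.
  exists (y.1 + e / 2, y.2).
    apply: yeU; split; rewrite /= /ball/= ?subrr ?normr0//.
    by rewrite opprD addrA subrr sub0r normrN gtr0_norm; lra.
  rewrite /= (_ : _ + _ = a * (e / 2)); last by rewrite -[RHS]add0r -h; ring.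
  by rewrite mulf_neq0// gt_eqF//; lra.
exists (y.1, y.2 + e / 2).
  apply: yeU; split; rewrite /= /ball/= ?subrr ?normr0//.
  by rewrite opprD addrA subrr sub0r normrN gtr0_norm; lra.
rewrite /= (_ : _ + _ = b * (e / 2)); last by rewrite -[RHS]add0r -h; ring.
by rewrite mulf_neq0// gt_eqF//; lra.
Qed.

(** Moving [x] slightly towards the centroid [g], where all barycentric coordinates are 1/3, makes
    them all positive. *)
Lemma tint_near (T : tri R) x e : Defs.nondegenerate T -> ctri T x -> 0 < e ->
  tint T `&` [set y | `|y.1 - x.1| < e /\ `|y.2 - x.2| < e] !=set0.
Proof.
move=> nT Tx e0.
pose g : pt := (((T 0%R).1 + (T 1%R).1 + (T 2%R).1) / 3,
                ((T 0%R).2 + (T 1%R).2 + (T 2%R).2) / 3).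
have D0 : tdet T != 0 by [].
have g1 : bary1 T g = 3^-1.
  by rewrite /bary1 /g/=; apply: (mulIf D0); rewrite mulfVK// /tdet; field.
have g2 : bary2 T g = 3^-1.
  by rewrite /bary2 /g/=; apply: (mulIf D0); rewrite mulfVK// /tdet; field.
pose M := `|g.1 - x.1| + `|g.2 - x.2|.
have M0 : 0 <= M by rewrite addr_ge0.
pose t := e / (e + M).
have eM : 0 < e + M by lra.
have t0 : 0 < t by rewrite divr_gt0.
have t1 : t <= 1 by rewrite ler_pdivrMr//; lra.
have tM : t * M < e.
  rewrite /t mulrAC ltr_pdivrMr// ltr_pM2l//; lra.
have tn (z : R) : `|z| <= M -> `|t * z| < e.
  move=> zM; rewrite normrM gtr0_norm//; apply: le_lt_trans tM.
  by rewrite ler_pM2l.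
exists (x.1 + t * (g.1 - x.1), x.2 + t * (g.2 - x.2)); split; last first.
  by split => /=; rewrite addrAC subrr add0r; apply: tn; rewrite /M ?lerDl ?lerDr.
move: Tx; rewrite ctriE// => -[x1 x2 x12].
have [a1 [b1 [c1 [_ E1]]]] := bary1_affine nT.
have [a2 [b2 [c2 [_ E2]]]] := bary2_affine nT.
have F1 : bary1 T (x.1 + t * (g.1 - x.1), x.2 + t * (g.2 - x.2)) =
   (1 - t) * bary1 T x + t * bary1 T g by rewrite !E1/=; ring.
have F2 : bary2 T (x.1 + t * (g.1 - x.1), x.2 + t * (g.2 - x.2)) =
   (1 - t) * bary2 T x + t * bary2 T g by rewrite !E2/=; ring.
rewrite /tint/= F1 F2 g1 g2.
have h1 : 0 <= (1 - t) * bary1 T x by rewrite mulr_ge0//; lra.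
have h2 : 0 <= (1 - t) * bary2 T x by rewrite mulr_ge0//; lra.
have h3 : (1 - t) * (bary1 T x + bary2 T x) <= 1 - t.
  by rewrite -[leRHS]mulr1 ler_wpM2l//; lra.
split; nra.
Qed.

End triangles.

(** If the two closed sets had no common point in [C], the trace of [A] on [C] would be both open
    and closed in [C], hence all of [C]. *)
Lemma connected_closed_cover (X : topologicalType) (C A B : set X) :
  connected C -> closed A -> closed B -> C `<=` A `|` B ->
  C `&` A !=set0 -> C `&` B !=set0 -> C `&` A `&` B !=set0.
Proof.
move=> cC cA cB CAB CA [b [Cb Bb]]; apply: contrapT => /nonemptyPn H.
have E : C `&` A = C.
  apply: cC => //; last by exists A.
  exists (~` B); first exact: closed_openC.
  apply/seteqP; split => x [Cx].
    by split => // Bx; have : (C `&` A `&` B) x by []; rewrite H.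
  by move=> nBx; split => //; case: (CAB _ Cx).
have : (C `&` A `&` B) b by rewrite E.
by rewrite H.
Qed.

(** * Connectedness of the mesh *)

Section mesh.
Variables (R : realType) (O : set (R * R)) (N : nat) (mesh : 'I_N -> tri R).
Local Notation pt := (R * R)%type.
Hypothesis hO : open O.
Hypothesis hmesh : triangulation O mesh.

Let nd k : Defs.nondegenerate (mesh k). Proof. by case: hmesh. Qed.

Lemma ctri_closure k : ctri (mesh k) `<=` closure O.
Proof. by case: hmesh => _ [-> _] x kx; exists k. Qed.

Lemma closure_ctri x : closure O x -> exists k, ctri (mesh k) x.
Proof. by case: hmesh => _ [-> _] [k _ kx]; exists k. Qed.

(** The open triangle is a nonempty open subset of [closure O], hence meets [O], though it need not
    lie inside [O]. *)
Lemma tint_meet k : O `&` tint (mesh k) !=set0.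
Proof.
have [|y [ky _]] := @tint_near _ (mesh k) (mesh k 0%R) 1 (nd k) _ ltr01.
  exact: ctri_vertex.
have : closure O y by apply: (@ctri_closure k); exact: tint_ctri.
move/(_ (tint (mesh k))) => -[|z [? ?]]; last by exists z.
by apply: open_nbhs_nbhs; split => //; exact: open_tint.
Qed.

Lemma tint_box k : exists (z : pt) (r : R), 0 < r /\
  (`[z.1 - r, z.1 + r] `*` `[z.2 - r, z.2 + r])%classic `<=` O `&` tint (mesh k).
Proof.
have [z Oz] := tint_meet k.
have : nbhs z (O `&` tint (mesh k)).
  by apply: open_nbhs_nbhs; split => //; apply: openI => //; exact: open_tint.
rewrite -nbhs_ballE => -[e /= e0 zeO].
exists z, (e / 2); split; first lra.
move=> y []; rewrite /= !in_itv/= => /andP[? ?] /andP[? ?]; apply: zeO.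
by split; rewrite /= /ball/= ltr_norml; apply/andP; split; lra.
Qed.

Lemma convex_lt (s a b e : R) : 0 <= s <= 1 -> a < e -> b < e -> (1 - s) * a + s * b < e.
Proof.
case/andP; rewrite le_eqVlt => /predU1P[<- _|s0 s1] ae be; first by rewrite subr0 mul1r mul0r addr0.
have h1 : 0 < s * (e - b) by rewrite mulr_gt0// subr_gt0.
have h2 : 0 <= (1 - s) * (e - a) by rewrite mulr_ge0//; lra.
lra.
Qed.

Lemma segment_closed_cover (A B : set pt) (y z : pt) : closed A -> closed B ->
  seg y z `<=` A `|` B -> A y -> B z -> exists2 x, seg y z x & A x /\ B x.
Proof.
move=> cA cB yzAB Ay Bz.
pose g (s : R) : pt := ((1 - s) * y.1 + s * z.1, (1 - s) * y.2 + s * z.2).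
have cg : continuous g.
  have ch (c d : R) : continuous (fun s : R => (1 - s) * c + s * d).
    move=> s; apply: cvgD; apply: cvgM; (try exact: cvg_cst); (try exact: cvg_id).
    by apply: cvgB; [exact: cvg_cst|exact: cvg_id].
  move=> s; exact: (@cvg_pair _ _ _ (nbhs s) (nbhs (g s).1) (nbhs (g s).2) _ _ _ _ _
    (ch y.1 z.1 s) (ch y.2 z.2 s)).
have g0 : g 0 = y by rewrite /g !subr0 !mul1r !mul0r !addr0; case: (y).
have g1 : g 1 = z by rewrite /g !subrr !mul1r !mul0r !add0r; case: (z).
have [||||||s [[s01 As] Bs]] := @connected_closed_cover (R : topologicalType) `[0, 1]%classic (g @^-1` A) (g @^-1` B).
- exact: segment_connected.
- by apply: closed_comp => // s _; exact: cg.
- by apply: closed_comp => // s _; exact: cg.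
- move=> s /= s01; apply: yzAB; exists s; split => //.
- by exists 0; split; [rewrite /= in_itv/= lexx ler01|rewrite /= g0].
- by exists 1; split; [rewrite /= in_itv/= lexx ler01|rewrite /= g1].
by exists (g s) => //; exists s; split.
Qed.

(* At a mesh vertex the propagation goes around the vertex: two triangles
   meeting there are joined by a short segment that avoids it. *)
Lemma mesh_connected (Z : 'I_N -> Prop) : connected O ->
  (forall k l x y, Z k -> x <> y -> ctri (mesh k) x -> ctri (mesh k) y ->
    ctri (mesh l) x -> ctri (mesh l) y -> Z l) ->
  (exists k, Z k) -> forall k, Z k.
Proof.
move=> hconn hZ [k0 Zk0] k1; apply: contrapT => nZk1.
(* The triangles with and without [Z] form two closed sets; connectedness of [O] will make them meet
   at a point of [O]. *)
pose A : set pt := \bigcup_(k in [set k | Z k]) ctri (mesh k).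
pose B : set pt := \bigcup_(k in [set k | ~ Z k]) ctri (mesh k).
have cA : closed A.
  by apply: closed_bigcup; [exact: finite_finset|move=> k _; exact: closed_ctri].
have cB : closed B.
  by apply: closed_bigcup; [exact: finite_finset|move=> k _; exact: closed_ctri].
have OAB : closure O `<=` A `|` B.
  by move=> x /closure_ctri[k kx]; have [?|?] := pselect (Z k); [left|right]; exists k.
(* By conformity a common point that is not a vertex lies on a common edge, whose two ends would
   pass [Z] on to [l]. *)
have AB k l x : Z k -> ~ Z l -> ctri (mesh k) x -> ctri (mesh l) x -> exists i, x = mesh k i.
  move=> Zk nZl kx lx; have kl : k != l by apply/eqP => e; apply: nZl; rewrite -e.
  case: hmesh => _ [_ /(_ k l kl)] [H|[[i [j [_ H]]]|[i [i' [j [j' [ii' [e [e' H]]]]]]]]].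
  - have : (ctri (mesh k) `&` ctri (mesh l)) x by []. by rewrite H.
  - have : (ctri (mesh k) `&` ctri (mesh l)) x by []. by rewrite H => ->; exists i.
  - exfalso; apply: nZl; apply: (hZ k l (mesh k i) (mesh k i')) => //.
    + by move=> h; move/eqP: ii'; apply; exact: (vertex_inj (nd k)).
    + exact: ctri_vertex.
    + exact: ctri_vertex.
    + by rewrite e; exact: ctri_vertex.
    + by rewrite e'; exact: ctri_vertex.
have [|||x [[Ox [k Zk kx]] [l nZl lx]]] := connected_closed_cover hconn cA cB.
- by move=> x Ox; apply: OAB; exact: subset_closure.
- have [x [Ox tx]] := tint_meet k0; exists x; split => //; exists k0 => //; exact: tint_ctri.
- have [x [Ox tx]] := tint_meet k1; exists x; split => //; exists k1 => //; exact: tint_ctri.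
(* There are finitely many mesh vertices, so some neighbourhood of [x] in [O] contains none of them
   except possibly [x]. *)
have Hp (p : 'I_N * 'I_3) : nbhs x [set y | mesh p.1 p.2 <> x -> y <> mesh p.1 p.2].
  have [e|e] := pselect (mesh p.1 p.2 = x); first by apply: filterE => y /(_ e).
  have oc : open (~` [set mesh p.1 p.2]).
    apply: closed_openC; apply: accessible_closed_set1; apply: hausdorff_accessible.
    exact: norm_hausdorff.
  have : nbhs x (~` [set mesh p.1 p.2]) by apply: open_nbhs_nbhs; split => // /esym.
  by apply: filterS => y h _.
have nO : nbhs x O by apply: open_nbhs_nbhs.
have /(nbhs_ballP x)[e /= e0 xeO] : nbhs x (O `&`
    [set y | forall p : 'I_N * 'I_3, mesh p.1 p.2 <> x -> y <> mesh p.1 p.2]).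
  exact: filterI nO (filter_forall (nbhs_filter x) Hp).
pose U : set pt := [set y | `|y.1 - x.1| < e /\ `|y.2 - x.2| < e].
have oU : open U.
  have -> : U = ball x e.
    apply/seteqP; split => y [] ? ?; split; rewrite /= /ball/=;
      by rewrite distrC.
  exact: ball_open.
have [y [ky Uy]] : exists2 y, (tint (mesh k) `&` U) y & 1 * y.1 + 0 * y.2 + (- x.1) != 0.
  apply: nonzero_affine_open; rewrite ?oner_eq0//.
    by apply: openI => //; exact: open_tint.
  exact: tint_near.
rewrite mul1r mul0r addr0 => yx.
(* [z] is taken off the line through [x] and [y], so that the segment from [y] to [z] misses [x]. *)
have [z [lz Uz]] : exists2 z, (tint (mesh l) `&` U) z &
    - (y.2 - x.2) * z.1 + (y.1 - x.1) * z.2 + ((y.2 - x.2) * x.1 - (y.1 - x.1) * x.2) != 0.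
  apply: nonzero_affine_open; rewrite ?yx ?orbT//.
    by apply: openI => //; exact: open_tint.
  exact: tint_near.
move=> yxz.
have segU : seg y z `<=` U.
  move=> _ [s [s01 ->]]; case: Uy Uz; rewrite /U/= !ltr_norml.
  have H (a b c : R) : - e < a - c < e -> - e < b - c < e ->
      - e < (1 - s) * a + s * b - c < e.
    move=> /andP[? ?] /andP[? ?].
    have : (1 - s) * a + s * b < e + c by apply: convex_lt => //; lra.
    have : (1 - s) * (- a) + s * (- b) < e - c by apply: convex_lt => //; lra.
    by move=> ? ?; apply/andP; split; lra.
  by move=> y1 y2 [z1 z2]; split; apply: H.
have UO w : U w -> O w /\ forall p : 'I_N * 'I_3, mesh p.1 p.2 <> x -> w <> mesh p.1 p.2.
  by move=> [w1 w2]; apply: xeO; split; rewrite /= /ball/= distrC.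
(* The segment lies in [O] and runs from [A] to [B], so it contains a point [w] of both; by [AB]
   this is a mesh vertex, and only [x] can be one inside [U]. *)
have [|||w yzw [[k' Zk' kw] [l' nZl' lw]]] := segment_closed_cover cA cB (y := y) (z := z).
- by move=> w /segU/UO[Ow _]; apply: OAB; exact: subset_closure.
- by exists k => //; exact: tint_ctri.
- by exists l => //; exact: tint_ctri.
have [i wi] := AB _ _ _ Zk' nZl' kw lw.
have [_ /(_ (k', i))/= H] := UO _ (segU _ yzw).
have {}wi : w = x by apply: contrapT => wx; apply: H => //; rewrite -wi.
case: yzw => s [/andP[s0 s1] ws].
have /= e1 : w.1 = x.1 by rewrite wi.
have /= e2 : w.2 = x.2 by rewrite wi.
rewrite ws/= in e1 e2.
have [s0'|s0'] := eqVneq s 0.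
  by move/eqP: yx; apply; rewrite -e1 s0'; ring.
(* Writing [x] as [(1 - s) y + s z] with nonzero [s] puts [z] on the line through [x] and [y],
   contrary to its choice. *)
move/eqP: yxz; apply; apply: (mulfI s0'); rewrite mulr0.
have E1 : s * (z.1 - x.1) = - (1 - s) * (y.1 - x.1) by rewrite -{1}e1 -e1; ring.
have E2 : s * (z.2 - x.2) = - (1 - s) * (y.2 - x.2) by rewrite -{1}e2 -e2; ring.
rewrite (_ : s * _ = (y.1 - x.1) * (s * (z.2 - x.2)) - (y.2 - x.2) * (s * (z.1 - x.1))).
  by rewrite E1 E2; ring.
by ring.
Qed.

(** Pigeonhole: [N.+1] distinct points of the segment are distributed over [N] triangles. *)
Lemma segment_two_points (a b : pt) : a <> b -> seg a b `<=` closure O ->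
  exists k x y, [/\ x <> y, seg a b x, seg a b y, ctri (mesh k) x & ctri (mesh k) y].
Proof.
move=> ab abO.
pose g (s : R) : pt := ((1 - s) * a.1 + s * b.1, (1 - s) * a.2 + s * b.2).
have gseg s : 0 <= s <= 1 -> seg a b (g s) by exists s.
have gi : injective g.
  move=> s t [e1 e2]; apply: contrapT => /eqP st; apply: ab.
  have st0 : s - t != 0 by rewrite subr_eq0.
  rewrite [a]surjective_pairing [b]surjective_pairing; congr (_, _).
    by apply: (mulfI st0); lra.
  by apply: (mulfI st0); lra.
pose s (i : 'I_N.+1) : R := i%:R / N.+1%:R.
have s01 i : 0 <= s i <= 1.
  rewrite /s divr_ge0//= ler_pdivrMr ?ltr0n// mul1r ler_nat; exact: ltnW.
have H i : exists k, ctri (mesh k) (g (s i)).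
  by apply: closure_ctri; apply: abO; exact: gseg.
have [F HF] := choice H.
have /injectivePn[i [j ij Fij]] : ~~ injectiveb F.
  apply/negP => /injectiveP /leq_card; by rewrite !card_ord ltnn.
exists (F i), (g (s i)), (g (s j)); split; try exact: gseg.
- move/gi; rewrite /s => /divIf; rewrite pnatr_eq0 => /(_ isT)/eqP.
  by rewrite eqr_nat => /eqP/val_inj e; rewrite e eqxx in ij.
- exact: HF.
- by rewrite Fij; exact: HF.
Qed.

End mesh.

(** * Piecewise polynomials on the core *)

Section quadratics.
Variable R : realType.
Local Notation pt := (R * R)%type.

Definition quad (c : nat -> R) (x : pt) : R :=
  c 0%N + c 1%N * x.1 + c 2%N * x.2 + c 3%N * x.1 ^+ 2 + c 4%N * (x.1 * x.2) + c 5%N * x.2 ^+ 2.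
(** The coefficients of the derivative, again in the format of [quad]; the default value 0 of the
    list lookup removes the quadratic terms. *)
Definition dquad (j : 'I_2) (c : nat -> R) (i : nat) : R :=
  if j == ord0 then [:: c 1%N; 2 * c 3%N; c 4%N]`_i else [:: c 2%N; c 4%N; 2 * c 5%N]`_i.
Definition coef1 (c : nat -> R) : R :=
  `|c 0%N| + `|c 1%N| + `|c 2%N| + `|c 3%N| + `|c 4%N| + `|c 5%N|.

Lemma coef1_ge0 c : 0 <= coef1 c.
Proof. by rewrite /coef1 !addr_ge0. Qed.

Lemma poly_on2P (T : tri R) v : poly_on 2 T v ->
  exists c, forall x, ctri T x -> v x = quad c x.
Proof.
case=> c H; exists (fun i => [:: c 0%N 0%N; c 1%N 0%N; c 0%N 1%N; c 2%N 0%N; c 1%N 1%N; c 0%N 2%N]`_i) => x /H ->.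
rewrite /quad/=.
do 4 (rewrite ?big_mkcond/= ?big_ord_recl/= ?big_ord0/= /bump/=).
by rewrite !addn0 !add1n !expr0 !expr1; ring.
Qed.

Lemma poly_on1_2 (T : tri R) v : poly_on 1 T v -> poly_on 2 T v.
Proof.
case=> c H; exists (fun a b => if (a + b <= 1)%N then c a b else 0) => x /H ->.
do 8 (rewrite ?big_mkcond/= ?big_ord_recl/= ?big_ord0/= /bump/=).
by rewrite !addn0 !add1n !expr0 !expr1; ring.
Qed.

Lemma poly_onB deg (T : tri R) v w : poly_on deg T v -> poly_on deg T w ->
  poly_on deg T (fun x => v x - w x).
Proof.
move=> [c Hc] [d Hd]; exists (fun a b => c a b - d a b) => x Tx.
rewrite Hc// Hd// -sumrB; apply: eq_bigr => a _; rewrite -sumrB.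
by apply: eq_bigr => b _; rewrite !mulrBl.
Qed.

Lemma quad_le c B (x : pt) : 1 <= B -> `|x.1| <= B -> `|x.2| <= B ->
  `|quad c x| <= coef1 c * B ^+ 2.
Proof.
move=> B1 x1 x2; rewrite /quad /coef1.
have B12 : 1 <= B ^+ 2 by rewrite expr_ge1//; lra.
have BB : B <= B ^+ 2 by rewrite expr2; nra.
have H (a b : R) : `|b| <= B ^+ 2 -> `|a * b| <= `|a| * B ^+ 2.
  by move=> h; rewrite normrM ler_wpM2l.
have := H (c 0%N) 1; rewrite normr1 => /(_ B12); rewrite mulr1 => h0.
have h1 : `|c 1%N * x.1| <= `|c 1%N| * B ^+ 2 by apply: H; lra.
have h2 : `|c 2%N * x.2| <= `|c 2%N| * B ^+ 2 by apply: H; lra.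
have h3 : `|c 3%N * x.1 ^+ 2| <= `|c 3%N| * B ^+ 2.
  by apply: H; rewrite normrX ler_pXn2r// ?nnegrE; lra.
have h4 : `|c 4%N * (x.1 * x.2)| <= `|c 4%N| * B ^+ 2.
  by apply: H; rewrite normrM expr2 ler_pM.
have h5 : `|c 5%N * x.2 ^+ 2| <= `|c 5%N| * B ^+ 2.
  by apply: H; rewrite normrX ler_pXn2r// ?nnegrE; lra.
rewrite !mulrDl.
by do 5 (apply: (le_trans (ler_normD _ _)); apply: lerD => //).
Qed.

Lemma dquad_coef1 j c : coef1 (dquad j c) <= 2 * coef1 c.
Proof.
rewrite /coef1 /dquad; case: ifP => _ /=; rewrite normr0 normrM ger0_norm//;
  have := normr_ge0 (c 0%N); have := normr_ge0 (c 1%N); have := normr_ge0 (c 2%N);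
  have := normr_ge0 (c 3%N); have := normr_ge0 (c 4%N); have := normr_ge0 (c 5%N); lra.
Qed.

Lemma measurable_quad c (D : set (mpt R)) : measurable_fun D (quad c : mpt R -> R).
Proof.
have m1 := @measurable_fst_plane R D; have m2 := @measurable_snd_plane R D.
have mc (a : R) (f : mpt R -> R) : measurable_fun D f -> measurable_fun D (fun x => a * f x).
  by move=> mf; apply: measurable_funM.
apply: measurable_funD; last by apply: mc; exact: measurable_funX.
apply: measurable_funD; last by apply: mc; exact: measurable_funM.
apply: measurable_funD; last by apply: mc; exact: measurable_funX.
apply: measurable_funD; last exact: mc.
by apply: measurable_funD; [exact: measurable_cst|exact: mc].
Qed.

Lemma partial_quad j c (x : pt) : partial j (quad c) x = quad (dquad j c) x.
Proof.
rewrite /partial /derive /e_; apply/cvg_lim => //.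
set D := quad (dquad j c) x.
(* The difference quotient of a quadratic is exactly [D + k * h], with [k] the coefficient of the
   square in direction [j]. *)
pose k := if j == ord0 then c 3%N else c 5%N.
apply: (@cvg_trans _ ((fun h : R => D + k * h) @ 0^')).
  apply: near_eq_cvg; near=> h.
  have h0 : h != 0 by near: h; exact: nbhs_dnbhs_neq.
  apply: (mulfI h0); rewrite /= /GRing.scale/= mulVKf//.
  by rewrite /D /k /quad /dquad; case: ifP => _ /=; rewrite scaler0 [_%:A]mulr1; ring.
have : (fun h : R => D + k * h) @ (0:R) --> D + k * 0.
  by apply: cvgD; [exact: cvg_cst|apply: cvgM; [exact: cvg_cst|exact: cvg_id]].
by rewrite mulr0 addr0; apply: cvg_trans; apply: cvg_app; exact: cvg_within.
Unshelve. all: by end_near. Qed.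

Lemma partial_near j c (v : pt -> R) (U : set pt) x : open U -> U x ->
  (forall y, U y -> v y = quad c y) -> partial j v x = quad (dquad j c) x.
Proof.
move=> oU Ux vc; rewrite -partial_quad; apply: near_eq_derive.
have : nbhs x U by apply: open_nbhs_nbhs.
by apply: filterS.
Qed.

End quadratics.

(** * Bounded measurable functions on the core and their integrals *)

Section core.
Variables (R : realType) (O : set (R * R)) (N : nat) (mesh : 'I_N -> tri R).
Local Notation pt := (R * R)%type.
Hypothesis hO : open O.
Hypothesis hmesh : triangulation O mesh.

Definition core : set (mpt R) := O `&` \bigcup_k tint (mesh k).

Let nd k : Defs.nondegenerate (mesh k). Proof. by case: hmesh. Qed.

Let mtint k : @measurable _ (mpt R) (O `&` tint (mesh k)).
Proof. by apply: open_measurable_plane; apply: openI => //; exact: open_tint. Qed.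

Lemma measurable_core : measurable core.
Proof.
apply: open_measurable_plane; apply: openI => //.
by apply: bigcup_open => k _; exact: open_tint.
Qed.

(** The difference is contained in three lines, on each of which one barycentric coordinate
    vanishes. *)
Lemma ctri_tint_null (T : tri R) : Defs.nondegenerate T ->
  (@leb2 R).-negligible ((ctri T `\` tint T) : set (mpt R)).
Proof.
move=> nT; have [a1 [b1 [c1 [ab1 E1]]]] := bary1_affine nT.
have [a2 [b2 [c2 [ab2 E2]]]] := bary2_affine nT.
have [a3 [b3 [c3 [ab3 E3]]]] := bary12_affine nT.
have L a b c : (a != 0) || (b != 0) ->
    (@leb2 R).-negligible [set x : mpt R | a * x.1 + b * x.2 + c = 0].
  by move=> /leb2_line0 => /(_ c)[mL L0]; apply/negligibleP.
apply: negligibleS (negligibleU (negligibleU (L _ _ c1 ab1) (L _ _ c2 ab2)) (L _ _ c3 ab3)).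
move=> x [Tx /= ntx]; apply: contrapT => nE; apply: ntx.
rewrite ctriE//= in Tx; case: Tx => h1 h2 h3.
have n1 : bary1 T x != 0 by apply/eqP => e; apply: nE; left; left; rewrite /= -E1.
have n2 : bary2 T x != 0 by apply/eqP => e; apply: nE; left; right; rewrite /= -E2.
have n3 : bary1 T x + bary2 T x != 1.
  by apply/eqP => e; apply: nE; right; rewrite /= -E3 e subrr.
by split; rewrite lt_neqAle ?h1 ?h2 ?h3 ?andbT// eq_sym.
Qed.

Let mO : @measurable _ (mpt R) O. Proof. exact: open_measurable_plane. Qed.

Lemma leb2_off_core : leb2 ((O : set (mpt R)) `\` core) = 0%E.
Proof.
apply/negligibleP; first by apply: measurableD => //; exact: measurable_core.
(* The finite family of triangle boundaries is continued by empty sets to a sequence, the form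
   needed for a countable union of negligible sets. *)
pose F (n : nat) : set (mpt R) := if insub n is Some k then
  ctri (mesh k) `\` tint (mesh k) else set0.
apply: (@negligibleS _ _ _ (@leb2 R) (\bigcup_n F n)); last first.
  apply: negligible_bigcup => n; rewrite /F; case: insubP => [k _ _|_].
    exact: ctri_tint_null.
  exact: negligible_set0.
move=> x [Ox ncx]; have /(closure_ctri hmesh)[k kx] : closure O x by exact: subset_closure.
exists (val k) => //; rewrite /F valK; split => // tx; apply: ncx.
by split => //; exists k.
Qed.

Lemma Rintegral_core (F : pt -> R) : Rintegral (@leb2 R) O F = Rintegral (@leb2 R) core F.
Proof.
rewrite /Rintegral; congr fine.
rewrite (@integral_setD_null _ (mpt R) R (@leb2 R) O (O `\` core)); last 2 first.
- by apply: measurableD => //; exact: measurable_core.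
- exact: leb2_off_core.
by rewrite setDD setIC setIidl// => x [].
Qed.

Lemma eq_Rintegral_core (F G : pt -> R) : (forall x, core x -> F x = G x) ->
  Rintegral (@leb2 R) O F = Rintegral (@leb2 R) O G.
Proof.
move=> FG; rewrite !Rintegral_core; apply: eq_Rintegral => x.
by rewrite inE => /FG.
Qed.

Hypothesis hO_bd : bounded_set O.

Lemma bounded_coord : exists B, 1 <= B /\ forall x, O x -> `|x.1| <= B /\ `|x.2| <= B.
Proof.
case: hO_bd => M [_ HM]; exists (Num.max M 0 + 1); split.
  by rewrite lerDr le_max lexx orbT.
have MM : M < Num.max M 0 + 1 by rewrite ltr_pwDr// le_max lexx.
move=> x Ox; have /= := HM _ MM x Ox.
by rewrite prod_normE/= ge_max => /andP[].
Qed.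

Lemma leb2_core_fin : (leb2 core < +oo)%E.
Proof.
have [B [B1 HB]] := bounded_coord.
apply: (@le_lt_trans _ _ (leb2 (`[-B, B]%classic `*` `[-B, B]%classic))).
  apply: le_measure; rewrite ?inE; [exact: measurable_core|exact: measurableX|].
  by move=> x [/HB[]]; rewrite !ler_norml => ? ? _; split; rewrite /= in_itv.
by rewrite leb2_box ?ltry//; lra.
Qed.

(** A class closed under sums and products whose members are integrable because the core has finite
    measure; it contains the finite element functions, their partial derivatives and the coefficient
    fields. *)
Definition good (F : pt -> R) : Prop :=
  measurable_fun core (F : mpt R -> R) /\ exists M, forall x, core x -> `|F x| <= M.

Lemma good_integrable F : good F -> (@leb2 R).-integrable core (EFin \o F).
Proof.
move=> [mF [M HM]]; apply: measurable_bounded_integrable => //.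
- exact: measurable_core.
- exact: leb2_core_fin.
- by exists M; split; [exact: num_real|move=> M' MM' x cx; apply: le_trans (HM x cx) (ltW MM')].
Qed.

Lemma goodD F G : good F -> good G -> good (fun x => F x + G x).
Proof.
move=> [mF [M HM]] [mG [M' HM']]; split; first exact: measurable_funD.
exists (M + M') => x cx; apply: le_trans (ler_normD _ _) _.
by apply: lerD; [exact: HM|exact: HM'].
Qed.

Lemma goodM F G : good F -> good G -> good (fun x => F x * G x).
Proof.
move=> [mF [M HM]] [mG [M' HM']]; split; first exact: measurable_funM.
exists (M * M') => x cx; rewrite normrM ler_pM//; [exact: HM|exact: HM'].
Qed.

Lemma good_cst a : good (fun=> a).
Proof. by split; [exact: measurable_cst|exists `|a|]. Qed.

Lemma goodZ a F : good F -> good (fun x => a * F x).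
Proof. by move=> gF; apply: goodM => //; exact: good_cst. Qed.

Lemma good_sum n (F : 'I_n -> pt -> R) : (forall i, good (F i)) ->
  good (fun x => \sum_(i < n) F i x).
Proof.
elim: n F => [|n IH] F gF.
  by under eq_fun do rewrite big_ord0; exact: good_cst.
by under eq_fun do rewrite big_ord_recr/=; apply: goodD => //; exact: IH.
Qed.

Lemma good_quad F : (forall k, exists c, forall x, O x -> tint (mesh k) x -> F x = quad c x) ->
  good F.
Proof.
move=> /choice[c Hc]; split.
  move=> _ Y mY; rewrite (_ : _ `&` _ = \bigcup_k (O `&` tint (mesh k) `&` (quad (c k) @^-1` Y))).
    by apply: fin_bigcup_measurable => // k _; apply: measurable_quad => //; exact: mtint.
  apply/seteqP; split => [x [[Ox [k _ kx]] Yx]|x [k _ [[Ox kx] Yx]]].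
    by exists k => //; split => //=; rewrite -(Hc k).
  by split; [split => //; exists k|rewrite /= (Hc k)].
have [B [B1 HB]] := bounded_coord.
exists (\sum_k coef1 (c k) * B ^+ 2) => x [Ox [k _ kx]].
have [x1 x2] := HB x Ox.
rewrite (Hc k)//; apply: (le_trans (quad_le _ B1 x1 x2)).
rewrite (bigD1 k)//= lerDl sumr_ge0// => i _.
by rewrite mulr_ge0 ?coef1_ge0// sqr_ge0.
Qed.

Lemma intD F G : good F -> good G ->
  Rintegral (@leb2 R) O (fun x => F x + G x) = Rintegral (@leb2 R) O F + Rintegral (@leb2 R) O G.
Proof.
move=> gF gG; rewrite !Rintegral_core.
by apply: RintegralD; [exact: measurable_core|exact: good_integrable..].
Qed.

Lemma intZ a F : good F -> Rintegral (@leb2 R) O (fun x => a * F x) = a * Rintegral (@leb2 R) O F.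
Proof.
move=> gF; rewrite !Rintegral_core.
by apply: RintegralZl; [exact: measurable_core|exact: good_integrable].
Qed.

Lemma int_le F G : good F -> good G -> (forall x, core x -> F x <= G x) ->
  Rintegral (@leb2 R) O F <= Rintegral (@leb2 R) O G.
Proof.
move=> gF gG FG; rewrite !Rintegral_core.
by apply: le_Rintegral => //; [exact: measurable_core|exact: good_integrable..].
Qed.

Lemma int_box_ge F m a b c d : good F -> (forall x, core x -> 0 <= F x) -> 0 <= m ->
  a <= b -> c <= d -> `[a, b] `*` `[c, d] `<=` core ->
  (forall x, (`[a, b] `*` `[c, d]) x -> m <= F x) ->
  m * ((b - a) * (d - c)) <= Rintegral (@leb2 R) O F.
Proof.
move=> gF F0 m0 ab cd sub Fm.
have mb : @measurable _ (mpt R) (`[a, b] `*` `[c, d]) by exact: measurableX.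
have -> : m * ((b - a) * (d - c)) = Rintegral (@leb2 R) core (m *: \1_(`[a, b] `*` `[c, d]) : mpt R -> R).
  transitivity (Rintegral (@leb2 R) (`[a, b] `*` `[c, d]) (fun=> m)).
    rewrite Rintegral_cst//; congr (_ * _); exact: esym (congr1 fine (leb2_box ab cd)).
  rewrite Rintegral_mkcond [RHS]Rintegral_mkcond; apply: eq_Rintegral => x _.
  rewrite /patch/= /GRing.scale/= indicE; case: (boolP (x \in `[a, b] `*` `[c, d])) => h.
    by rewrite ifT ?mulr1//; move: h; rewrite !inE => /sub.
  by rewrite mulr0; case: ifP.
rewrite Rintegral_core; apply: le_Rintegral; first exact: measurable_core.
- apply: good_integrable; split.
    by apply: measurable_funM => //; exact: measurable_indic.
  exists m => x _ /=; rewrite /GRing.scale/= indicE; case: (_ \in _).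
    by rewrite mulr1 ger0_norm.
  by rewrite mulr0 normr0.
- exact: good_integrable.
move=> x cx; rewrite /GRing.scale/= indicE.
case: (boolP (x \in _)) => h; last by rewrite mulr0 F0.
by rewrite mulr1 Fm//; rewrite inE in h.
Qed.

Lemma cpw1_2 v : cpw 1 O mesh v -> cpw 2 O mesh v.
Proof. by move=> [cv h]; split => // k; exact: poly_on1_2. Qed.

Lemma cpwB deg v w : cpw deg O mesh v -> cpw deg O mesh w ->
  cpw deg O mesh (fun x => v x - w x).
Proof.
move=> [cv hv] [cw hw]; split; last by move=> k; exact: poly_onB.
by move=> x; apply: cvgB; [exact: cv|exact: cw].
Qed.

Lemma cpw_good v : cpw 2 O mesh v -> good v.
Proof.
move=> [_ h]; apply: good_quad => k; have [c Hc] := poly_on2P (h k).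
by exists c => x _ kx; apply: Hc; exact: tint_ctri.
Qed.

Lemma cpw_partial_good j v : cpw 2 O mesh v -> good (partial j v).
Proof.
move=> [_ h]; apply: good_quad => k; have [c Hc] := poly_on2P (h k).
exists (dquad j c) => x _ kx; apply: partial_near kx _; first exact: open_tint.
by move=> y ky; apply: Hc; exact: tint_ctri.
Qed.

(** Near a point of the core both functions are quadratic polynomials, so [derive] is the true
    derivative there and is additive. *)
Lemma partial_coreB j v w x : cpw 2 O mesh v -> cpw 2 O mesh w -> core x ->
  partial j (fun x => v x - w x) x = partial j v x - partial j w x.
Proof.
move=> [_ hv] [_ hw] [Ox [k _ kx]].
have [c Hc] := poly_on2P (hv k); have [d Hd] := poly_on2P (hw k).
have oT := open_tint (nd k); have sub := tint_ctri (nd k).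
rewrite (partial_near j oT kx (fun y ky => Hc y (sub y ky))).
rewrite (partial_near j oT kx (fun y ky => Hd y (sub y ky))).
rewrite (@partial_near _ j (fun i => c i - d i) _ _ _ oT kx).
  by rewrite /quad /dquad; case: ifP => _ /=; ring.
by move=> y /sub ky; rewrite Hc// Hd// /quad; ring.
Qed.

End core.

(** * Null sequences and affine functions on a box *)

Section null_sequences.
Variable R : realType.
Implicit Types u v : nat -> R.

Definition nul u : Prop := u i @[i --> \oo] --> (0 : R).

Lemma nul0 : nul (fun=> 0). Proof. exact: cvg_cst. Qed.

Lemma nulD u v : nul u -> nul v -> nul (fun i => u i + v i).
Proof. by move=> hu hv; rewrite /nul -[X in _ --> X]addr0; exact: cvgD hu hv. Qed.

Lemma nulZ a u : nul u -> nul (fun i => a * u i).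
Proof. by move=> hu; rewrite /nul -[X in _ --> X](mulr0 a); exact: cvgM (cvg_cst a) hu. Qed.

Lemma nulB u v : nul u -> nul v -> nul (fun i => u i - v i).
Proof. by move=> hu hv; rewrite /nul -[X in _ --> X]subr0; exact: cvgB hu hv. Qed.

Lemma nul_norm u : nul u -> nul (fun i => `|u i|).
Proof. by move=> hu; rewrite /nul -[X in _ --> X](@normr0 R R); exact: cvg_norm hu. Qed.

Lemma nul_eq u v : (forall i, v i = u i) -> nul u -> nul v.
Proof. by move=> /funext ->. Qed.

Lemma nul_sum n (F : 'I_n -> nat -> R) : (forall k, nul (F k)) ->
  nul (fun i => \sum_(k < n) F k i).
Proof.
elim: n F => [|n IH] F hF; first by apply: nul_eq nul0 => i; rewrite big_ord0.
apply: nul_eq (nulD (IH _ (fun k => hF (widen_ord (leqnSn n) k))) (hF ord_max)) => i.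
by rewrite big_ord_recr.
Qed.

Lemma nul_le u v : (forall i, `|v i| <= u i) -> nul u -> nul v.
Proof.
move=> vu hu; apply: norm_cvg0.
apply: (@squeeze_cvgr _ _ _ _ (fun=> 0) u) => //; last exact: cvg_cst.
by apply: nearW => i; rewrite normr_ge0 vu.
Qed.

Lemma nul_mul_le k u v : 0 < k -> (forall i, 0 <= v i) -> (forall i, k * v i <= u i) ->
  nul u -> nul v.
Proof.
move=> k0 v0 vu hu; apply: nul_le (nulZ k^-1 hu) => i.
by rewrite ger0_norm// [leRHS]mulrC ler_pdivlMr// mulrC.
Qed.

Lemma nul_sqrt u : nul u -> nul (fun i => Num.sqrt (u i)).
Proof.
move=> hu; rewrite /nul -[X in _ --> X](@sqrtr0 R).
exact: (continuous_cvg _ (@sqrt_continuous R 0) hu).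
Qed.

Lemma nul_sqr u : nul u -> nul (fun i => u i ^+ 2).
Proof. by move=> hu; rewrite /nul -[X in _ --> X](mulr0 0); exact: (cvgM hu hu). Qed.

Lemma nul_shift u : nul (fun i => u i.+1) -> nul u.
Proof. by move=> h; have := h; rewrite /nul (cvg_shiftS u). Qed.

End null_sequences.

Section box_estimate.
Variables (R : realType) (O : set (R * R)) (N : nat) (mesh : 'I_N -> tri R).
Local Notation pt := (R * R)%type.
Hypothesis hO : open O.
Hypothesis hmesh : triangulation O mesh.
Hypothesis hO_bd : bounded_set O.
Local Notation core := (core O mesh).
Local Notation good := (good O mesh).

(** The outer quarter of the interval, on the side given by the sign of [b]: there [x - z] has that
    sign and size at least [r / 2]. *)
Lemma half_interval (b z r : R) : 0 < r -> exists a, [/\ z - r <= a, a + r / 2 <= z + r &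
  forall x, a <= x <= a + r / 2 -> `|b| * (r / 2) <= b * (x - z)].
Proof.
move=> r0; have [b0|b0] := leP 0 b.
  exists (z + r / 2); split; [lra|lra|move=> x /andP[? ?]].
  by rewrite ger0_norm// ler_wpM2l//; lra.
exists (z - r); split; [lra|lra|move=> x /andP[? ?]].
by rewrite ltr0_norm// -[leRHS]mulrNN ler_wpM2l//; lra.
Qed.

(** On a square of side [r / 2] in a suitable corner of the box no two of the three terms have
    opposite signs, so the affine function is at least [M] in modulus. The bound is [M ^+ 2] times
    the area of that square. *)
Lemma box_affine_ge (F : pt -> R) (z : pt) (r e b c : R) : 0 < r -> good F ->
  (forall x, core x -> 0 <= F x) ->
  `[z.1 - r, z.1 + r] `*` `[z.2 - r, z.2 + r] `<=` core ->
  (forall x, (`[z.1 - r, z.1 + r] `*` `[z.2 - r, z.2 + r]) x ->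
    (e + b * (x.1 - z.1) + c * (x.2 - z.2)) ^+ 2 <= F x) ->
  ((`|e| + `|b| * r + `|c| * r) * (r / 4)) ^+ 2 <= Rintegral (@leb2 R) O F.
Proof.
move=> r0 gF F0 sub HF.
pose M := (`|e| + `|b| * r + `|c| * r) / 2.
have b0 := normr_ge0 b; have c0 := normr_ge0 c; have e0 := normr_ge0 e.
have br0 : 0 <= `|b| * r by rewrite mulr_ge0// ltW.
have cr0 : 0 <= `|c| * r by rewrite mulr_ge0// ltW.
have M0 : 0 <= M by rewrite /M; lra.
have [a1 [a2 [ha1 ha1' ha2 ha2' Ha]]] : exists a1 a2, [/\ z.1 - r <= a1, a1 + r / 2 <= z.1 + r,
    z.2 - r <= a2, a2 + r / 2 <= z.2 + r &
  forall x y, a1 <= x <= a1 + r / 2 -> a2 <= y <= a2 + r / 2 ->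
    M ^+ 2 <= (e + b * (x - z.1) + c * (y - z.2)) ^+ 2].
  have [e1|e1] := leP 0 e.
    have [a1 [? ? H1]] := half_interval b z.1 r0.
    have [a2 [? ? H2]] := half_interval c z.2 r0.
    exists a1, a2; split => // x y /H1 h1 /H2 h2.
    by rewrite ler_sqr ?nnegrE//; rewrite ?/M; have := ger0_norm e1; lra.
  have [a1 [? ? H1]] := half_interval (- b) z.1 r0.
  have [a2 [? ? H2]] := half_interval (- c) z.2 r0.
  exists a1, a2; split => // x y /H1 + /H2; rewrite !normrN => h1 h2.
  rewrite -[leRHS]sqrrN.
  by rewrite ler_sqr ?nnegrE//; rewrite ?/M; have := ltr0_norm e1; lra.
have subb : `[a1, a1 + r / 2] `*` `[a2, a2 + r / 2] `<=`
    `[z.1 - r, z.1 + r] `*` `[z.2 - r, z.2 + r].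
  move=> x []; rewrite /= !in_itv/= => /andP[? ?] /andP[? ?].
  by split; apply/andP; split; lra.
have := @int_box_ge R O N mesh hO hmesh hO_bd F (M ^+ 2) a1 (a1 + r / 2) a2 (a2 + r / 2) gF F0.
rewrite sqr_ge0 => /(_ isT) H.
apply: le_trans (H _ _ _ _); [|lra|lra|by move=> x /subb/sub|].
  by rewrite /M le_eqVlt; apply/orP; left; apply/eqP; field.
move=> x bx; apply: le_trans (HF x (subb _ bx)).
by case: bx; rewrite /= !in_itv/=; exact: Ha.
Qed.

Lemma box_affine_nul (F : nat -> pt -> R) (z : pt) (r : R) (a b c : nat -> R) : 0 < r ->
  (forall i, good (F i)) -> (forall i x, core x -> 0 <= F i x) ->
  `[z.1 - r, z.1 + r] `*` `[z.2 - r, z.2 + r] `<=` core ->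
  (forall i x, (`[z.1 - r, z.1 + r] `*` `[z.2 - r, z.2 + r]) x ->
    (a i + b i * x.1 + c i * x.2) ^+ 2 <= F i x) ->
  nul (fun i => Rintegral (@leb2 R) O (F i)) -> [/\ nul a, nul b & nul c].
Proof.
move=> r0 gF F0 sub HF nF.
(* [e i] is the value at the centre of the box; [a i] is recovered from it once the slopes tend to
   0. *)
pose e i := a i + b i * z.1 + c i * z.2.
have H i : (`|e i| + `|b i| * r + `|c i| * r) * (r / 4) <=
    Num.sqrt (Rintegral (@leb2 R) O (F i)).
  rewrite -[leLHS]ger0_norm; last by rewrite !mulr_ge0 ?addr_ge0 ?mulr_ge0//; lra.
  rewrite -sqrtr_sqr; apply: ler_wsqrtr; apply: (box_affine_ge r0 (gF i) (F0 i) sub).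
  move=> x bx; apply: le_trans (HF i x bx); rewrite le_eqVlt /e; apply/orP; left; apply/eqP; ring.
have nH := nulZ (r / 4)^-1 (nul_sqrt nF).
have r4 : 0 < r / 4 by lra.
have H' i : `|e i| + `|b i| * r + `|c i| * r <=
    (r / 4)^-1 * Num.sqrt (Rintegral (@leb2 R) O (F i)).
  by rewrite [leRHS]mulrC ler_pdivlMr.
have b0 i : 0 <= `|b i| * r by rewrite mulr_ge0// ltW.
have c0 i : 0 <= `|c i| * r by rewrite mulr_ge0// ltW.
have ne : nul e.
  by apply: nul_le nH => i; have := H' i; have := b0 i; have := c0 i; lra.
have nb : nul b.
  apply: nul_le (nulZ r^-1 nH) => i; rewrite [leRHS]mulrC ler_pdivlMr//.
  by have := H' i; have := normr_ge0 (e i); have := c0 i; lra.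
have nc : nul c.
  apply: nul_le (nulZ r^-1 nH) => i; rewrite [leRHS]mulrC ler_pdivlMr//.
  by have := H' i; have := normr_ge0 (e i); have := b0 i; lra.
split => //; apply: nul_eq (nulB (nulB ne (nulZ z.1 nb)) (nulZ z.2 nc)) => i.
by rewrite /e; ring.
Qed.

End box_estimate.

(** * Korn's inequality *)

Section korn.
Variables (R : realType) (O Gd : set (R * R)) (N : nat) (mesh : 'I_N -> tri R).
Local Notation pt := (R * R)%type.
Hypothesis hO : open O.
Hypothesis hmesh : triangulation O mesh.
Hypothesis hO_bd : bounded_set O.
Local Notation core := (core O mesh).
Local Notation good := (good O mesh).
Local Notation o1 := (lift ord0 ord0 : 'I_2).

Let nd k : Defs.nondegenerate (mesh k). Proof. by case: hmesh. Qed.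

Lemma big_ord2 (F : 'I_2 -> R) : \sum_(i < 2) F i = F ord0 + F o1.
Proof. by rewrite !big_ord_recl big_ord0 addr0. Qed.

Lemma good_strain (u : pt -> pt) i j : (forall i, cpw 2 O mesh (vcomp i u)) -> good (strain u i j).
Proof.
move=> hu; have := goodZ 2^-1 (goodD (cpw_partial_good hO hmesh hO_bd i (hu j))
  (cpw_partial_good hO hmesh hO_bd j (hu i))).
by congr good; apply/funext => x; rewrite /strain mulrC addrC.
Qed.

Lemma good_strain_ip (u v : pt -> pt) : (forall i, cpw 2 O mesh (vcomp i u)) ->
  (forall i, cpw 2 O mesh (vcomp i v)) ->
  good (fun x => \sum_(i < 2) \sum_(j < 2) strain u i j x * strain v i j x).
Proof.
move=> hu hv; apply: good_sum => // i; apply: good_sum => // j.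
by apply: goodM => //; exact: good_strain.
Qed.

Section sequence.
Variables (w : nat -> pt -> pt) (c : nat -> 'I_N -> 'I_2 -> nat -> R).
Hypothesis hw : forall i j, cpw 2 O mesh (vcomp j (w i)).
Hypothesis hc : forall i k j x, ctri (mesh k) x -> vcomp j (w i) x = quad (c i k j) x.
Hypothesis hs : nul (fun i => strain_ip O (w i) (w i)).

Lemma partial_tint i k j l x : tint (mesh k) x ->
  partial l (vcomp j (w i)) x = quad (dquad l (c i k j)) x.
Proof.
move=> kx; apply: partial_near kx _; first exact: open_tint.
by move=> y ky; apply: hc; exact: tint_ctri.
Qed.

(** Each strain entry is affine on the triangle and its square is dominated by the energy density,
    so its three coefficients tend to 0. The resulting nine combinations of the twelve coefficients
    leave only the three parameters of an infinitesimal rigid motion. *)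
Lemma strain_coef_nul k :
  [/\ nul (fun i => c i k ord0 1%N), nul (fun i => c i k ord0 3%N) &
      nul (fun i => c i k ord0 4%N)] /\
  [/\ nul (fun i => c i k o1 2%N), nul (fun i => c i k o1 4%N) &
      nul (fun i => c i k o1 5%N)] /\
  [/\ nul (fun i => c i k ord0 2%N + c i k o1 1%N), nul (fun i => c i k o1 3%N) &
      nul (fun i => c i k ord0 5%N)].
Proof.
have [z [r [r0 sub]]] := tint_box hO hmesh k.
have subc : `[z.1 - r, z.1 + r] `*` `[z.2 - r, z.2 + r] `<=` core.
  by move=> x /sub[Ox kx]; split => //; exists k.
pose F i x := \sum_(p < 2) \sum_(q < 2) strain (w i) p q x * strain (w i) p q x.
have gF i : good (F i) by apply: good_strain_ip => j; exact: hw.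
have F0 i x : core x -> 0 <= F i x.
  by move=> _; apply: sumr_ge0 => p _; apply: sumr_ge0 => q _; rewrite -expr2 sqr_ge0.
have Fge i x p q : strain (w i) p q x ^+ 2 <= F i x.
  rewrite /F (bigD1 p)//= (bigD1 q)//= -expr2 -addrA lerDl addr_ge0//.
    by apply: sumr_ge0 => ? _; rewrite -expr2 sqr_ge0.
  by apply: sumr_ge0 => ? _; apply: sumr_ge0 => ? _; rewrite -expr2 sqr_ge0.
have H p q (a b d : nat -> R) : (forall i x, tint (mesh k) x ->
    a i + b i * x.1 + d i * x.2 = strain (w i) p q x) -> [/\ nul a, nul b & nul d].
  move=> Hs; apply: (box_affine_nul hO hmesh hO_bd r0 gF F0 subc _ hs) => i x bx.
  by rewrite (Hs i x); [exact: Fge|have [] := sub x bx].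
have [n1 n2 n3] := H ord0 ord0 (fun i => c i k ord0 1%N) (fun i => 2 * c i k ord0 3%N)
  (fun i => c i k ord0 4%N) ltac:(by move=> i x kx; rewrite /strain !(partial_tint _ _ _ kx)
    /quad /dquad /=; field).
have [n4 n5 n6] := H o1 o1 (fun i => c i k o1 2%N) (fun i => c i k o1 4%N)
  (fun i => 2 * c i k o1 5%N) ltac:(by move=> i x kx; rewrite /strain !(partial_tint _ _ _ kx)
    /quad /dquad /=; field).
have [n7 n8 n9] := H ord0 o1 (fun i => (c i k ord0 2%N + c i k o1 1%N) / 2)
  (fun i => (c i k ord0 4%N + 2 * c i k o1 3%N) / 2)
  (fun i => (2 * c i k ord0 5%N + c i k o1 4%N) / 2)
  ltac:(by move=> i x kx; rewrite /strain !(partial_tint _ _ _ kx) /quad /dquad /=; field).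
split; [|split]; split => //.
- by apply: nul_eq (nulZ 2^-1 n2) => i; field.
- by apply: nul_eq (nulZ 2^-1 n6) => i; field.
- by apply: nul_eq (nulZ 2 n7) => i; field.
- by apply: nul_eq (nulB n8 (nulZ 2^-1 n3)) => i; field.
- by apply: nul_eq (nulB n9 (nulZ 2^-1 n5)) => i; field.
Qed.

(* The infinitesimal rigid motions (a, b) + t (y, -x) are determined by two points. *)
Lemma coef_nul k (P Q : pt) : P <> Q -> ctri (mesh k) P -> ctri (mesh k) Q ->
  (forall j, nul (fun i => vcomp j (w i) P)) -> (forall j, nul (fun i => vcomp j (w i) Q)) ->
  forall j, nul (fun i => coef1 (c i k j)).
Proof.
move=> PQ kP kQ nP nQ.
have [[a1 a3 a4] [[b2 b4 b5] [ab b3 a5]]] := strain_coef_nul k.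
(* Up to terms tending to 0 the displacement at [x] is a rigid motion with rotation
   [c i k ord0 2%N]; [A] and [B] isolate its two components. *)
have A (x : pt) : ctri (mesh k) x -> nul (fun i => vcomp ord0 (w i) x) ->
    nul (fun i => c i k ord0 0%N + x.2 * c i k ord0 2%N).
  move=> kx nx; apply: nul_eq (nulB nx (nulD (nulD (nulZ x.1 a1) (nulZ (x.1 ^+ 2) a3))
    (nulD (nulZ (x.1 * x.2) a4) (nulZ (x.2 ^+ 2) a5)))) => i.
  by rewrite (hc _ _ kx) /quad; ring.
have B (x : pt) : ctri (mesh k) x -> nul (fun i => vcomp o1 (w i) x) ->
    nul (fun i => c i k o1 0%N - x.1 * c i k ord0 2%N).
  move=> kx nx; apply: nul_eq (nulB nx (nulD (nulD (nulZ x.2 b2) (nulZ (x.1 ^+ 2) b3))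
    (nulD (nulD (nulZ (x.1 * x.2) b4) (nulZ (x.2 ^+ 2) b5)) (nulZ x.1 ab)))) => i.
  by rewrite (hc _ _ kx) /quad; ring.
have AP := A P kP (nP ord0); have AQ := A Q kQ (nQ ord0).
have BP := B P kP (nP o1); have BQ := B Q kQ (nQ o1).
(* The rotation comes from the difference of the values at [P] and [Q], using a coordinate in which
   the points differ; the translation follows. *)
have a2 : nul (fun i => c i k ord0 2%N).
  have [e|e] := eqVneq P.2 Q.2.
    have h : P.1 - Q.1 != 0.
      rewrite subr_eq0; apply/eqP => e1; apply: PQ.
      by rewrite [P]surjective_pairing [Q]surjective_pairing e e1.
    by apply: nul_eq (nulZ (P.1 - Q.1)^-1 (nulB BQ BP)) => i; field.
  rewrite -subr_eq0 in e.
  by apply: nul_eq (nulZ (P.2 - Q.2)^-1 (nulB AP AQ)) => i; field.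
have a0 : nul (fun i => c i k ord0 0%N).
  by apply: nul_eq (nulB AP (nulZ P.2 a2)) => i; ring.
have b0 : nul (fun i => c i k o1 0%N).
  by apply: nul_eq (nulD BP (nulZ P.1 a2)) => i; ring.
have b1 : nul (fun i => c i k o1 1%N).
  by apply: nul_eq (nulB ab a2) => i; ring.
move=> j; have [->|->] : j = ord0 \/ j = o1.
- by case: j => -[|[|//]] ?; [left|right]; exact: val_inj.
- by rewrite /coef1; repeat apply: nulD; exact: nul_norm.
- by rewrite /coef1; repeat apply: nulD; exact: nul_norm.
Qed.

Hypothesis hO_conn : connected O.
Hypothesis hGd_sub : Gd `<=` bdry O.
Hypothesis hGd_pos : exists a b : pt, a <> b /\ seg a b `<=` Gd.
Hypothesis hGd0 : forall i x j, Gd x -> vcomp j (w i) x = 0.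

Lemma all_coef_nul k j : nul (fun i => coef1 (c i k j)).
Proof.
have val k' x j' : (forall j, nul (fun i => coef1 (c i k' j))) -> ctri (mesh k') x ->
    nul (fun i => vcomp j' (w i) x).
  move=> nc kx; pose M := 1 + `|x.1| + `|x.2|.
  have x1 := normr_ge0 x.1; have x2 := normr_ge0 x.2.
  apply: nul_le (nulZ (M ^+ 2) (nc j')) => i; rewrite (hc _ _ kx) mulrC.
  by apply: quad_le; rewrite /M; lra.
(* The property passed from triangle to triangle is convergence to 0 at each of its points; two
   points shared with the next triangle suffice to transfer it. *)
have Z : forall k', forall x, ctri (mesh k') x -> forall j, nul (fun i => vcomp j (w i) x).
  apply: (mesh_connected hO hmesh hO_conn).
    move=> k' l x y Zk' xy kx ky lx ly z lz j'; apply: val lz => j''.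
    by apply: (coef_nul xy lx ly) => ?; exact: Zk'.
  (* The start is a triangle containing two points of the clamped segment, where every [w i]
     vanishes. *)
  case: hGd_pos => a [b [ab abG]].
  have abO : seg a b `<=` closure O by move=> x /abG/hGd_sub[].
  have [k' [x [y [xy abx aby kx ky]]]] := segment_two_points hmesh ab abO.
  exists k' => z kz j'; apply: val kz => j''.
  by apply: (coef_nul xy kx ky) => ?; apply: nul_eq (@nul0 R) => i; apply: hGd0; exact: abG.
apply: (@coef_nul k (mesh k 0%R) (mesh k 1%R)) => //.
- by move/(vertex_inj (nd k)).
- exact: ctri_vertex.
- exact: ctri_vertex.
- by apply: Z; exact: ctri_vertex.
- by apply: Z; exact: ctri_vertex.
Qed.

(** The integral of 1 is the finite measure of the core, by which a uniform bound becomes an L^2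
    bound. *)
Lemma L2ip_nul (F : nat -> pt -> R) (s : nat -> R) C : (forall i, good (F i)) ->
  (forall i x, core x -> `|F i x| <= C * s i) -> nul s ->
  nul (fun i => L2ip O (F i) (F i)).
Proof.
move=> gF HF ns.
apply: nul_le (nulZ (Rintegral (@leb2 R) O (fun=> 1)) (nul_sqr (nulZ C ns))) => i.
rewrite ger0_norm; last by apply: Rintegral_ge0 => x _; rewrite -expr2 sqr_ge0.
rewrite mulrC -(intZ hO hmesh hO_bd); last exact: good_cst.
apply: (int_le hO hmesh hO_bd).
- exact: goodM.
- by apply: goodZ; exact: good_cst.
move=> x cx; rewrite mulr1 -expr2 -[leLHS]real_normK ?num_real//.
rewrite ler_sqr ?nnegrE//; first exact: HF.
exact: le_trans (HF i x cx).
Qed.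

Lemma korn_nul : nul (fun i => vH1norm O (w i)).
Proof.
have [B [B1 HB]] := bounded_coord hO_bd.
pose s i := \sum_(k < N) \sum_(j < 2) coef1 (c i k j).
have ns : nul s by apply: nul_sum => k; apply: nul_sum => j; exact: all_coef_nul.
have sge i k j : coef1 (c i k j) <= s i.
  rewrite /s (bigD1 k)//= (bigD1 j)//= -addrA lerDl addr_ge0//.
    by apply: sumr_ge0 => ? _; exact: coef1_ge0.
  by apply: sumr_ge0 => ? _; apply: sumr_ge0 => ? _; exact: coef1_ge0.
have B2 : 0 <= B ^+ 2 by exact: sqr_ge0.
have n0 j : nul (fun i => L2ip O (vcomp j (w i)) (vcomp j (w i))).
  apply: (@L2ip_nul _ s (B ^+ 2)) => // [i|i x [Ox [k _ kx]]]; first exact: cpw_good.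
  have [x1 x2] := HB x Ox.
  rewrite (hc i j (tint_ctri (nd k) kx)); apply: (le_trans (quad_le _ B1 x1 x2)).
  by rewrite mulrC ler_wpM2l.
have n1 j l : nul (fun i => L2ip O (partial l (vcomp j (w i))) (partial l (vcomp j (w i)))).
  apply: (@L2ip_nul _ s (2 * B ^+ 2)) => // [i|i x [Ox [k _ kx]]]; first exact: cpw_partial_good.
  have [x1 x2] := HB x Ox.
  rewrite (partial_tint i j l kx); apply: (le_trans (quad_le _ B1 x1 x2)).
  rewrite [leRHS]mulrAC ler_wpM2r//; apply: le_trans (dquad_coef1 _ _) _.
  by rewrite ler_wpM2l.
have nH j : nul (fun i => H1norm O (vcomp j (w i))).
  by apply: nul_sqrt; apply: nulD => //; apply: nul_sum => l; exact: n1.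
by apply: nul_sqrt; apply: nul_sum => j; apply: nul_sqr.
Qed.

End sequence.

Lemma discrete_korn (w : nat -> pt -> pt) : connected O -> Gd `<=` bdry O ->
  (exists a b : pt, a <> b /\ seg a b `<=` Gd) -> (forall i, Vh O Gd mesh (w i)) ->
  nul (fun i => strain_ip O (w i) (w i)) -> nul (fun i => vH1norm O (w i)).
Proof.
move=> hconn hsub hpos hw hs.
have /choice[c Hc] : forall a : nat * 'I_N * 'I_2, exists c : nat -> R,
    forall x, ctri (mesh a.1.2) x -> vcomp a.2 (w a.1.1) x = quad c x.
  by move=> [[i k] j] /=; case: (hw i) => /(_ j)[_ /(_ k)/poly_on2P].
apply: (@korn_nul w (fun i k j => c (i, k, j))) => //.
- by move=> i j; case: (hw i).
- by move=> i k j x; exact: (Hc (i, k, j)).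
- by move=> i x j Gx; case: (hw i) => _; exact.
Qed.

End korn.

(** * Energy estimate *)

(** A nonincreasing sequence bounded below converges, so its decrements, which dominate [d], tend to
    0. *)
Lemma decrease_nul (R : realType) (x d : nat -> R) : (forall i, 0 <= x i) ->
  (forall i, 0 <= d i) -> (forall i, x i.+1 + d i <= x i) -> nul d.
Proof.
move=> x0 d0 xd.
have cx : cvgn x.
  apply: nonincreasing_is_cvgn.
    apply/nonincreasing_seqP => i; have := xd i; have := d0 i; lra.
  by exists 0 => _ [i _ <-].
have nx : nul (fun i => x i - x i.+1).
  rewrite /nul -[X in _ --> X](subrr (limn x)); apply: cvgB => //.
  by rewrite (cvg_shiftS x).
apply: nul_le nx => i; rewrite ger0_norm//; have := xd i; lra.
Qed.

(** Double letters are inner products of errors: P and T for pressure and temperature, X and Y for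
    [xi] before and after the step; [S], [KP], [KT] are energies and [D] is the divergence coupling.
    Let Z2 be the last right-hand side of the conclusion. Step 1 with Young's inequality gives Z2 +
    2 lam dt (KP + KT) <= XX, and Step 2 with Young's inequality gives YY + 4 mu lam S <= Z2. *)
Lemma energy_step (R : realFieldType) (lam mu alpha beta a0 b0 c0 dt : R)
    (PP PT TT XX XP XT YY YP YT S D KP KT : R) :
  0 < lam -> 0 < mu -> 0 <= b0 -> b0 <= a0 -> b0 <= c0 ->
  0 <= PP -> 0 <= TT -> 0 <= PP + TT - 2 * PT -> 0 <= S ->
  (c0 + alpha ^+ 2 / lam) * PP + (alpha * beta / lam - b0) * PT + dt * KP = alpha / lam * XP ->
  (a0 + beta ^+ 2 / lam) * TT + (alpha * beta / lam - b0) * PT + dt * KT = beta / lam * XT ->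
  2 * mu * S - D = 0 -> D + 1 / lam * YY = alpha / lam * YP + beta / lam * YT ->
  2 * alpha * XP + 2 * beta * XT <=
    XX + alpha ^+ 2 * PP + beta ^+ 2 * TT + 2 * alpha * beta * PT ->
  2 * alpha * YP + 2 * beta * YT <=
    YY + alpha ^+ 2 * PP + beta ^+ 2 * TT + 2 * alpha * beta * PT ->
  YY + (4 * mu * lam * S + 2 * lam * dt * (KP + KT)) <= XX /\
  YY <= alpha ^+ 2 * PP + beta ^+ 2 * TT + 2 * alpha * beta * PT.
Proof.
move=> l0 m0 b00 ba bc P0 T0 PT0 S0 e1 e2 e3 e4 q1 q2.
have ln : lam != 0 by rewrite gt_eqF.
have {}e1 : (lam * c0 + alpha ^+ 2) * PP + (alpha * beta - lam * b0) * PT + lam * dt * KP = alpha * XP.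
  have : lam * (alpha / lam * XP) = alpha * XP by field.
  by rewrite -e1 => <-; field.
have {}e2 : (lam * a0 + beta ^+ 2) * TT + (alpha * beta - lam * b0) * PT + lam * dt * KT = beta * XT.
  have : lam * (beta / lam * XT) = beta * XT by field.
  by rewrite -e2 => <-; field.
have {}e4 : lam * D + YY = alpha * YP + beta * YT.
  have : lam * (alpha / lam * YP + beta / lam * YT) = alpha * YP + beta * YT by field.
  by rewrite -e4 => <-; field.
have eD : D = 2 * mu * S by lra.
(* The storage term lam (c0 PP + a0 TT - 2 b0 PT) is split into three terms that are nonnegative by
   [b0 <= c0] and [b0 <= a0]. *)
have h1 : 0 <= lam * (c0 - b0) * PP by rewrite !mulr_ge0 ?subr_ge0// ltW.
have h2 : 0 <= lam * (a0 - b0) * TT by rewrite !mulr_ge0 ?subr_ge0// ltW.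
have h3 : 0 <= lam * b0 * (PP + TT - 2 * PT) by rewrite !mulr_ge0// ltW.
have h4 : 0 <= lam * mu * S by rewrite !mulr_ge0// ltW.
subst D.
by split; lra.
Qed.

(** * The bilinear forms of the scheme and Poincare's inequality *)

Section bilinear.
Variables (R : realType) (O Gd : set (R * R)) (N : nat) (mesh : 'I_N -> tri R).
Local Notation pt := (R * R)%type.
Hypothesis hO : open O.
Hypothesis hmesh : triangulation O mesh.
Hypothesis hO_bd : bounded_set O.
Local Notation core := (core O mesh).
Local Notation good := (good O mesh).
Local Notation o1 := (lift ord0 ord0 : 'I_2).
Local Notation cpw2 u := (forall i, cpw 2 O mesh (vcomp i u)).

Lemma intB (F G : pt -> R) : good F -> good G ->
  Rintegral (@leb2 R) O (fun x => F x - G x) =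
  Rintegral (@leb2 R) O F - Rintegral (@leb2 R) O G.
Proof.
move=> gF gG; rewrite -mulN1r -(intZ hO hmesh hO_bd _ gG).
rewrite -(intD hO hmesh hO_bd)//; last exact: goodZ.
by congr Rintegral; apply/funext => x; rewrite mulN1r.
Qed.

Lemma intB_core (F G H : pt -> R) : good F -> good G ->
  (forall x, core x -> H x = F x - G x) ->
  Rintegral (@leb2 R) O H = Rintegral (@leb2 R) O F - Rintegral (@leb2 R) O G.
Proof. by move=> gF gG HFG; rewrite -intB//; exact: eq_Rintegral_core HFG. Qed.

Lemma L2ipC (f g : pt -> R) : L2ip O f g = L2ip O g f.
Proof. by rewrite /L2ip; congr Rintegral; apply/funext => x; rewrite mulrC. Qed.

Lemma L2ip_ge0 (f : pt -> R) : 0 <= L2ip O f f.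
Proof. by apply: Rintegral_ge0 => x _; rewrite -expr2 sqr_ge0. Qed.

Lemma L2ipBl (f g h : pt -> R) : good f -> good g -> good h ->
  L2ip O (f - g) h = L2ip O f h - L2ip O g h.
Proof.
move=> gf gg gh; apply: intB_core; [exact: goodM|exact: goodM|].
by move=> x _; rewrite -mulrBl.
Qed.

(** Expansion of the nonnegative integral of the square of [f - a g - b h]. *)
Lemma L2ip_young (f g h : pt -> R) (a b : R) : good f -> good g -> good h ->
  2 * a * L2ip O f g + 2 * b * L2ip O f h <=
  L2ip O f f + a ^+ 2 * L2ip O g g + b ^+ 2 * L2ip O h h + 2 * a * b * L2ip O g h.
Proof.
move=> gf gg gh; rewrite -subr_ge0.
have gff := goodM gf gf; have ggg := goodM gg gg; have ghh := goodM gh gh.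
have gfg := goodM gf gg; have gfh := goodM gf gh; have ggh := goodM gg gh.
have : 0 <= Rintegral (@leb2 R) O (fun x => f x * f x + a ^+ 2 * (g x * g x) +
    b ^+ 2 * (h x * h x) + 2 * a * b * (g x * h x) + (- (2 * a)) * (f x * g x) +
    (- (2 * b)) * (f x * h x)).
  apply: Rintegral_ge0 => x _.
  rewrite (_ : _ + _ = (f x - a * g x - b * h x) ^+ 2) ?sqr_ge0//; ring.
rewrite !(intD hO hmesh hO_bd)// ?(intZ hO hmesh hO_bd)//;
  repeat first [exact: goodZ | apply: goodD => //].
by congr (0 <= _); rewrite /L2ip; ring.
Qed.

Lemma vcomp_vsub i (u v : pt -> pt) :
  vcomp i (vsub u v) = (fun x => vcomp i u x - vcomp i v x).
Proof. by apply/funext => x; rewrite /vcomp; case: ifP. Qed.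

Lemma VhB (u v : pt -> pt) : Vh O Gd mesh u -> Vh O Gd mesh v -> Vh O Gd mesh (vsub u v).
Proof.
move=> [hu u0] [hv v0]; split=> [i|x Gx i]; rewrite vcomp_vsub; first exact: cpwB.
by rewrite u0// v0// subrr.
Qed.

Lemma WhB (p q : pt -> R) : Wh O mesh p -> Wh O mesh q -> Wh O mesh (p - q).
Proof.
move=> [hp p0] [hq q0]; split; first exact: cpwB.
by move=> x bx; rewrite /= -[LHS]/(p x - q x) p0// q0// subrr.
Qed.

Lemma strain_coreB (u v : pt -> pt) i j x : cpw2 u -> cpw2 v -> core x ->
  strain (vsub u v) i j x = strain u i j x - strain v i j x.
Proof.
move=> hu hv cx; rewrite /strain !vcomp_vsub !(partial_coreB hmesh)//.
by rewrite -mulrBl; congr (_ / _); ring.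
Qed.

Lemma strain_ipBl (u u' v : pt -> pt) : cpw2 u -> cpw2 u' -> cpw2 v ->
  strain_ip O (vsub u u') v = strain_ip O u v - strain_ip O u' v.
Proof.
move=> hu hu' hv; apply: intB_core; try exact: good_strain_ip.
move=> x cx; rewrite -sumrB; apply: eq_bigr => i _; rewrite -sumrB; apply: eq_bigr => j _.
by rewrite strain_coreB// mulrBl.
Qed.

Lemma good_divv (u : pt -> pt) : cpw2 u -> good (divv u).
Proof. by move=> hu; apply: good_sum => i; exact: cpw_partial_good. Qed.

Lemma L2ip_divvBl (u v : pt -> pt) q : cpw2 u -> cpw2 v -> good q ->
  L2ip O (divv (vsub u v)) q = L2ip O (divv u) q - L2ip O (divv v) q.
Proof.
move=> hu hv gq.
apply: intB_core; try (by apply: goodM => //; exact: good_divv).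
move=> x cx; rewrite -mulrBl; congr (_ * _); rewrite /divv -sumrB; apply: eq_bigr => i _.
by rewrite vcomp_vsub (partial_coreB hmesh).
Qed.

Section field.
Variables (K : pt -> 'M[R]_2) (km kM : R).
Hypothesis hK : spd_field O K km kM.

(** The bound on [K v], applied to the [j]-th unit vector, bounds every entry by [kM]. *)
Lemma good_field i j : good (fun x => K x i j).
Proof.
case: hK => km0 [kM0 [mK HK]]; split.
  apply: measurable_funS (mK i j); first exact: open_measurable_plane.
  by move=> x [].
exists kM => x [Ox _]; have [_ /(_ (fun l => (l == j)%:R))[]] := HK x Ox.
  by exists j; rewrite eqxx oner_eq0.
move=> _ /=; rewrite [X in _ <= _ * Num.sqrt X](_ : _ = 1); last first.
  by rewrite (bigD1 j)//= eqxx expr1n big1 ?addr0// => l /negbTE ->; rewrite expr0n.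
rewrite sqrtr1 mulr1; apply: le_trans.
rewrite -sqrtr_sqr; apply: ler_wsqrtr; rewrite (bigD1 i)//=.
have -> : \sum_(j0 < 2) K x i j0 * (j0 == j)%:R = K x i j.
  by rewrite (bigD1 j)//= eqxx mulr1 big1 ?addr0// => l /negbTE ->; rewrite mulr0.
by rewrite lerDl sumr_ge0// => l _; exact: sqr_ge0.
Qed.

Lemma good_Kgrad p q : cpw 2 O mesh p -> cpw 2 O mesh q ->
  good (fun x => \sum_(i < 2) (\sum_(j < 2) K x i j * partial j p x) * partial i q x).
Proof.
move=> hp hq; apply: good_sum => i; apply: goodM; last exact: cpw_partial_good.
by apply: good_sum => j; apply: goodM; [exact: good_field|exact: cpw_partial_good].
Qed.

Lemma Kgrad_ipBl p p' q : cpw 2 O mesh p -> cpw 2 O mesh p' -> cpw 2 O mesh q ->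
  Kgrad_ip O K (p - p') q = Kgrad_ip O K p q - Kgrad_ip O K p' q.
Proof.
move=> hp hp' hq; apply: intB_core; try exact: good_Kgrad.
move=> x cx; rewrite -sumrB; apply: eq_bigr => i _; rewrite -mulrBl; congr (_ * _).
rewrite -sumrB; apply: eq_bigr => j _; rewrite -mulrBr; congr (_ * _).
exact: (partial_coreB hmesh).
Qed.

Lemma Kgrad_coercive p : cpw 2 O mesh p ->
  km * Rintegral (@leb2 R) O (fun x => \sum_(i < 2) partial i p x ^+ 2) <= Kgrad_ip O K p p.
Proof.
move=> hp; have gs : good (fun x => \sum_(i < 2) partial i p x ^+ 2).
  by apply: good_sum => i; apply: goodM; exact: cpw_partial_good.
rewrite -(intZ hO hmesh hO_bd)//; apply: (int_le hO hmesh hO_bd).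
- exact: goodZ.
- exact: good_Kgrad.
move=> x [Ox _]; case: hK => _ [_ [_ /(_ x Ox)[_ HK]]].
(* Ellipticity is stated for nonzero vectors, so a vanishing gradient is treated apart. *)
have [[i i0]|n0] := pselect (exists i, partial i p x != 0).
  have [+ _] := HK (fun i => partial i p x) (ex_intro _ i i0).
  move=> /le_trans; apply; rewrite le_eqVlt; apply/orP; left; apply/eqP.
  apply: eq_bigr => l _; rewrite mulr_suml; apply: eq_bigr => j _; ring.
have z i : partial i p x = 0.
  by apply/eqP; apply: contrapT => /negP h; apply: n0; exists i.
by rewrite !big1 ?mulr0// => i _; rewrite z ?mulr0// expr0n.
Qed.

End field.

(* A scalar p is treated as the vector field (p, 0), whose strain controls
   grad p, so that Poincare's inequality is a case of Korn's. *)
Lemma poincare_nul (p : nat -> pt -> R) : connected O -> Gd `<=` bdry O ->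
  (exists a b : pt, a <> b /\ seg a b `<=` Gd) -> (forall i, Wh O mesh (p i)) ->
  nul (fun i => Rintegral (@leb2 R) O (fun x => \sum_(j < 2) partial j (p i) x ^+ 2)) ->
  nul (fun i => H1norm O (p i)).
Proof.
move=> hconn hsub hpos hp hn.
pose w i (x : pt) : pt := (p i x, 0).
have w0 i : vcomp ord0 (w i) = p i by [].
have w1 i : vcomp o1 (w i) = cst 0 by [].
have j01 (j : 'I_2) : j = ord0 \/ j = o1.
  by case: j => -[|[|//]] ?; [left|right]; exact: val_inj.
have hp2 i : cpw 2 O mesh (p i) by apply: cpw1_2; case: (hp i).
have hw i : Vh O Gd mesh (w i).
  split.
    move=> j; case: (j01 j) => ->; first by rewrite w0.
    rewrite w1; split; first by move=> x; exact: cvg_cst.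
    move=> k; exists (fun _ _ => 0) => x _; rewrite big1// => a _; rewrite big1// => b _.
    by rewrite !mul0r.
  move=> x /hsub bx j; case: (j01 j) => ->; last by rewrite w1.
  by rewrite w0; case: (hp i) => _; exact.
have hw2 i j : cpw 2 O mesh (vcomp j (w i)) by case: (hw i).
(* The strain energy density of [(p, 0)] is p_x^2 + p_y^2 / 2, at most the squared gradient. *)
have hs : nul (fun i => strain_ip O (w i) (w i)).
  apply: nul_le hn => i; rewrite ger0_norm; last first.
    apply: Rintegral_ge0 => x _; apply: sumr_ge0 => a _; apply: sumr_ge0 => b _.
    by rewrite -expr2 sqr_ge0.
  apply: (int_le hO hmesh hO_bd).
  - exact: good_strain_ip.
  - by apply: good_sum => j; apply: goodM; exact: cpw_partial_good.
  move=> x _; rewrite !big_ord2 /strain !w0 !w1.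
  have z j : partial j (cst 0) x = 0 :> R by exact: derive_cst.
  rewrite !z; have := sqr_ge0 (partial ord0 (p i) x); have := sqr_ge0 (partial o1 (p i) x).
  by rewrite !expr2; lra.
apply: nul_le (discrete_korn hO hmesh hO_bd hconn hsub hpos hw hs) => i.
rewrite ger0_norm ?sqrtr_ge0// -[leLHS]ger0_norm ?sqrtr_ge0// -sqrtr_sqr.
by apply: ler_wsqrtr; rewrite big_ord2 w0 lerDl sqr_ge0.
Qed.

End bilinear.

(* [ring] would otherwise compare the integrals up to conversion. *)
Ltac abstract_forms := repeat match goal with
  | |- context [L2ip ?a ?b ?c] => generalize (L2ip a b c); intro
  | |- context [Kgrad_ip ?a ?b ?c ?d] => generalize (Kgrad_ip a b c d); intro
  | |- context [strain_ip ?a ?b ?c] => generalize (strain_ip a b c); intro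
  | |- context [vL2ip ?a ?b ?c] => generalize (vL2ip a b c); intro
  end.

(** Presents an error equation as the difference between an equation of the iteration and one of the
    coupled problem, leaving an identity for [ring]. *)
Lemma eq_by_sub (V : zmodType) (a b c d x y : V) :
  a = b -> c = d -> x - y = (a - b) - (c - d) -> x = y.
Proof. by move=> -> -> /eqP; rewrite !subrr subr_eq0 => /eqP. Qed.

Lemma dissipation_nul (R : realType) (lam mu dt : R) (x S KP KT : nat -> R) :
  0 < lam -> 0 < mu -> 0 < dt -> (forall i, 0 <= x i) ->
  (forall i, 0 <= S i) -> (forall i, 0 <= KP i) -> (forall i, 0 <= KT i) ->
  (forall i, x i.+1 + (4 * mu * lam * S i + 2 * lam * dt * (KP i + KT i)) <= x i) ->
  nul S /\ nul KP /\ nul KT.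
Proof.
move=> l0 m0 t0 x0 S0 P0 T0 xd.
have ml0 : 0 < mu * lam by rewrite mulr_gt0.
have ld0 : 0 < lam * dt by rewrite mulr_gt0.
have d1 i : 0 <= mu * lam * S i by rewrite mulr_ge0// ltW.
have d2 i : 0 <= lam * dt * KP i by rewrite mulr_ge0// ltW.
have d3 i : 0 <= lam * dt * KT i by rewrite mulr_ge0// ltW.
have nd : nul (fun i => 4 * mu * lam * S i + 2 * lam * dt * (KP i + KT i)).
  by apply: decrease_nul x0 _ xd => i; have := d1 i; have := d2 i; have := d3 i; lra.
by split; [|split]; [apply: (nul_mul_le ml0) nd => // i|apply: (nul_mul_le ld0) nd => // i..];
  have := d1 i; have := d2 i; have := d3 i; lra.
Qed.

Lemma combination_nul (R : realType) (alpha beta : R) (PP TT PT YY : nat -> R) :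
  0 < alpha -> 0 < beta -> (forall i, 0 <= PP i) -> (forall i, 0 <= TT i) ->
  (forall i, 0 <= YY i) -> (forall i, 0 <= PP i + TT i - 2 * PT i) -> nul PP -> nul TT ->
  (forall i, YY i <= alpha ^+ 2 * PP i + beta ^+ 2 * TT i + 2 * alpha * beta * PT i) ->
  nul YY.
Proof.
move=> a0 b0 P0 T0 Y0 PT0 nP nT hY.
(* The coefficients come from replacing [2 * PT] by its upper bound [PP + TT]. *)
apply: nul_le (nulD (nulZ (alpha ^+ 2 + alpha * beta) nP)
  (nulZ (beta ^+ 2 + alpha * beta) nT)) => i.
have ab0 : 0 < alpha * beta by rewrite mulr_gt0.
rewrite ger0_norm//; apply: le_trans (hY i) _.
have := mulr_ge0 (ltW ab0) (PT0 i); lra.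
Qed.

Lemma L2ip_H1norm_nul (R : realType) (O : set (R * R)) (q : nat -> R * R -> R) :
  nul (fun i => H1norm O (q i)) -> nul (fun i => L2ip O (q i) (q i)).
Proof.
move=> nq; apply: nul_le (nul_sqr nq) => i; rewrite ger0_norm ?L2ip_ge0// sqr_sqrtr.
  by rewrite lerDl sumr_ge0// => j _; exact: L2ip_ge0.
by rewrite addr_ge0 ?L2ip_ge0// sumr_ge0// => j _; exact: L2ip_ge0.
Qed.

(** * Convergence of the iterates to the coupled solution *)

Unset Implicit Arguments. Set Strict Implicit. Set Printing Implicit Defensive.

Theorem theorem4p2 (R : realType)
  (* domain, boundary parts, triangulation *)
  (O Gd : set (R * R)) (N : nat) (mesh : 'I_N -> tri R)
  (hO_bd : bounded_set O) (hO_open : open O) (hO_conn : connected O)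
  (hmesh : triangulation O mesh)
  (hGd_sub : Gd `<=` bdry O) (hGd_ne : Gd <> bdry O)
  (hGd_pos : exists a b : R * R, a <> b /\ seg a b `<=` Gd)
  (* inf-sup condition for V_h x Q_h *)
  (gamma : R) (hgamma : 0 < gamma)
  (hinfsup : forall xi, Qh O mesh xi -> 0 < L2norm O xi ->
     forall e : R, 0 < e -> exists v, Vh O Gd mesh v /\ 0 < vH1norm O v /\
       gamma - e < L2ip O (divv v) xi / (vH1norm O v * L2norm O xi))
  (* (A1) *)
  (K Th : R * R -> 'M[R]_2) (km kM tm tM : R)
  (hK : spd_field O K km kM) (hTh : spd_field O Th tm tM)
  (* (A2), (A3) *)
  (lam mu alpha beta a0 b0 c0 : R)
  (hlam : 0 < lam) (hmu : 0 < mu) (halpha : 0 < alpha) (hbeta : 0 < beta)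
  (hb0 : 0 <= b0) (ha0 : b0 <= a0) (hc0 : b0 <= c0)
  (* data *)
  (f : R * R -> R * R) (g Hs : R * R -> R)
  (hf : forall i, inL2 O (vcomp i f)) (hg : inL2 O g) (hHs : inL2 O Hs)
  (* time step and previous values *)
  (dt : R) (hdt : 0 < dt)
  (xi0 p0 T0 : R * R -> R)
  (hxi0 : Qh O mesh xi0) (hp0 : Wh O mesh p0) (hT0 : Wh O mesh T0)
  (* the solution of the coupled problem at step n *)
  (u : R * R -> R * R) (xi p T : R * R -> R)
  (hu : Vh O Gd mesh u) (hxi : Qh O mesh xi) (hp : Wh O mesh p) (hT : Wh O mesh T)
  (hE1 : forall v, Vh O Gd mesh v ->
     2 * mu * strain_ip O u v - L2ip O (divv v) xi = vL2ip O f v)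
  (hE2 : forall phi, Qh O mesh phi ->
     - L2ip O (divv u) phi - 1 / lam * L2ip O xi phi
     + alpha / lam * L2ip O p phi + beta / lam * L2ip O T phi = 0)
  (hE3 : forall q, Wh O mesh q ->
     - (alpha / lam) * L2ip O xi q + (c0 + alpha ^+ 2 / lam) * L2ip O p q
     + (alpha * beta / lam - b0) * L2ip O T q + dt * Kgrad_ip O K p q
     = (c0 + alpha ^+ 2 / lam) * L2ip O p0 q + (alpha * beta / lam - b0) * L2ip O T0 q
       - alpha / lam * L2ip O xi0 q + dt * L2ip O g q)
  (hE4 : forall S, Wh O mesh S ->
     - (beta / lam) * L2ip O xi S + (a0 + beta ^+ 2 / lam) * L2ip O T S
     + (alpha * beta / lam - b0) * L2ip O p S + dt * Kgrad_ip O Th T S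
     = (a0 + beta ^+ 2 / lam) * L2ip O T0 S + (alpha * beta / lam - b0) * L2ip O p0 S
       - beta / lam * L2ip O xi0 S + dt * L2ip O Hs S)
  (* the iterates *)
  (us : nat -> R * R -> R * R) (xis ps Ts : nat -> R * R -> R)
  (hinit : xis 0%N = xi0 /\ ps 0%N = p0 /\ Ts 0%N = T0)
  (hstep1 : forall i : nat,
     Wh O mesh (ps i.+1) /\ Wh O mesh (Ts i.+1) /\
     (forall q, Wh O mesh q ->
        (c0 + alpha ^+ 2 / lam) * L2ip O (ps i.+1) q
        + (alpha * beta / lam - b0) * L2ip O (Ts i.+1) q
        + dt * Kgrad_ip O K (ps i.+1) q
        = dt * L2ip O g q + (c0 + alpha ^+ 2 / lam) * L2ip O p0 q
          + (alpha * beta / lam - b0) * L2ip O T0 q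
          + alpha / lam * L2ip O (xis i) q - alpha / lam * L2ip O xi0 q) /\
     (forall S, Wh O mesh S ->
        (a0 + beta ^+ 2 / lam) * L2ip O (Ts i.+1) S
        + (alpha * beta / lam - b0) * L2ip O (ps i.+1) S
        + dt * Kgrad_ip O Th (Ts i.+1) S
        = dt * L2ip O Hs S + (a0 + beta ^+ 2 / lam) * L2ip O T0 S
          + (alpha * beta / lam - b0) * L2ip O p0 S
          + beta / lam * L2ip O (xis i) S - beta / lam * L2ip O xi0 S))
  (hstep2 : forall i : nat,
     Vh O Gd mesh (us i.+1) /\ Qh O mesh (xis i.+1) /\
     (forall v, Vh O Gd mesh v ->
        2 * mu * strain_ip O (us i.+1) v - L2ip O (divv v) (xis i.+1) = vL2ip O f v) /\
     (forall phi, Qh O mesh phi ->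
        L2ip O (divv (us i.+1)) phi + 1 / lam * L2ip O (xis i.+1) phi
        = alpha / lam * L2ip O (ps i.+1) phi + beta / lam * L2ip O (Ts i.+1) phi))
  : vH1norm O (vsub (us i) u) @[i --> \oo] --> 0 /\
    L2norm O (xis i - xi) @[i --> \oo] --> 0 /\
    H1norm O (ps i - p) @[i --> \oo] --> 0 /\
    H1norm O (Ts i - T) @[i --> \oo] --> 0.
Proof.
have hxi' i : Qh O mesh (xis i).
  case: i => [|i]; first by case: hinit => -> _.
  by case: (hstep2 i) => _ [? _].
have hps i : Wh O mesh (ps i.+1) by case: (hstep1 i) => ? _.
have hTs i : Wh O mesh (Ts i.+1) by case: (hstep1 i) => _ [? _].
have hus i : Vh O Gd mesh (us i.+1) by case: (hstep2 i) => ? _.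
(* The indices are staggered: Step 1 computes [P i] and [Q i] from [X i], and Step 2 then yields
   [W i] and [X i.+1]. *)
pose X i := xis i - xi; pose P i := ps i.+1 - p; pose Q i := Ts i.+1 - T.
pose W i := vsub (us i.+1) u.
have gQ q : Qh O mesh q -> good O mesh q by move=> /cpw1_2; exact: (cpw_good hO_open hmesh hO_bd).
have gW q : Wh O mesh q -> good O mesh q by case=> /gQ.
have cW q : Wh O mesh q -> cpw 2 O mesh q by case=> /cpw1_2.
have cV v : Vh O Gd mesh v -> forall i, cpw 2 O mesh (vcomp i v) by case.
have hX i : Qh O mesh (X i) by exact: (cpwB (hxi' i) hxi).
have hP i : Wh O mesh (P i) by exact: WhB.
have hQ i : Wh O mesh (Q i) by exact: WhB.
have hW i : Vh O Gd mesh (W i) by exact: VhB.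
have dB v q : Vh O Gd mesh v -> Qh O mesh q -> good O mesh (divv v) /\ good O mesh q.
  by move=> hv hq; split; [apply: good_divv => //; exact: cV|exact: gQ].
pose S i := strain_ip O (W i) (W i).
pose KP i := Kgrad_ip O K (P i) (P i).
pose KT i := Kgrad_ip O Th (Q i) (Q i).
have lX i q : good O mesh q -> L2ip O (X i) q = L2ip O (xis i) q - L2ip O xi q.
  by move=> gq; apply: (L2ipBl hO_open hmesh hO_bd) => //; exact: gQ.
have lP i q : good O mesh q -> L2ip O (P i) q = L2ip O (ps i.+1) q - L2ip O p q.
  by move=> gq; apply: (L2ipBl hO_open hmesh hO_bd) => //; exact: gW.
have lQ i q : good O mesh q -> L2ip O (Q i) q = L2ip O (Ts i.+1) q - L2ip O T q.
  by move=> gq; apply: (L2ipBl hO_open hmesh hO_bd) => //; exact: gW.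
have gX i : good O mesh (X i) by exact: gQ.
have gP i : good O mesh (P i) by exact: gW.
have gT i : good O mesh (Q i) by exact: gW.
have PQ0 i : 0 <= L2ip O (P i) (P i) + L2ip O (Q i) (Q i) - 2 * L2ip O (P i) (Q i).
  (* Young's inequality with coefficients 1 and 0 is 2 (P, Q) <= (P, P) + (Q, Q). *)
  move: (L2ip_young hO_open hmesh hO_bd 1 0 (gP i) (gT i) (gT i)).
  by abstract_forms; rewrite !expr1n !expr0n /=; lra.
have main i : L2ip O (X i.+1) (X i.+1) + (4 * mu * lam * S i + 2 * lam * dt * (KP i + KT i))
    <= L2ip O (X i) (X i) /\
  L2ip O (X i.+1) (X i.+1) <= alpha ^+ 2 * L2ip O (P i) (P i) + beta ^+ 2 * L2ip O (Q i) (Q i)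
    + 2 * alpha * beta * L2ip O (P i) (Q i).
  have [_ [_ [s1 s2]]] := hstep1 i; have [_ [_ [s3 s4]]] := hstep2 i.
  apply: (@energy_step _ lam mu alpha beta a0 b0 c0 dt _ _ _ _ (L2ip O (X i) (P i))
    (L2ip O (X i) (Q i)) _ (L2ip O (X i.+1) (P i)) (L2ip O (X i.+1) (Q i)) _
    (L2ip O (divv (W i)) (X i.+1))) => //.
  - exact: L2ip_ge0.
  - exact: L2ip_ge0.
  - apply: Rintegral_ge0 => x _; apply: sumr_ge0 => a _; apply: sumr_ge0 => b _.
    by rewrite -expr2 sqr_ge0.
  (* Pressure equation of Step 1 minus its coupled counterpart, tested with the error [P i]; the
     source and previous-step terms cancel. The temperature equation is tested with [Q i]
     likewise. *)
  - rewrite /KP [X in dt * X](Kgrad_ipBl hO_open hmesh hO_bd hK); try by exact: cW.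
    rewrite [L2ip O (P i) (Q i)]L2ipC !lP// lQ// lX//.
    move: (s1 _ (hP i)) (hE3 _ (hP i)); abstract_forms => h1 h2; apply: (eq_by_sub h1 h2); ring.
  - rewrite /KT [X in dt * X](Kgrad_ipBl hO_open hmesh hO_bd hTh); try by exact: cW.
    rewrite lP// !lQ// lX//.
    move: (s2 _ (hQ i)) (hE4 _ (hQ i)); abstract_forms => h1 h2; apply: (eq_by_sub h1 h2); ring.
  (* The momentum equations are subtracted and tested with [W i], so that [f] cancels. *)
  - rewrite /S (strain_ipBl hO_open hmesh hO_bd); try by exact: cV.
    rewrite [L2ip O (divv _) _]L2ipC lX; last by case: (dB _ _ (hW i) (hX i)).
    rewrite ![L2ip O _ (divv _)]L2ipC.
    move: (s3 _ (hW i)) (hE1 _ (hW i)); abstract_forms => h1 h2; apply: (eq_by_sub h1 h2); ring.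
  (* The constraint equations are tested with the new error [X i.+1]; the coupled one has the
     opposite sign convention and is therefore reversed. *)
  - rewrite (L2ip_divvBl hO_open hmesh hO_bd) //; try by exact: cV.
    rewrite ![L2ip O (X i.+1) (P i)]L2ipC ![L2ip O (X i.+1) (Q i)]L2ipC lP// lQ// lX//.
    move: (s4 _ (hX i.+1)) (esym (hE2 _ (hX i.+1))); abstract_forms => h1 h2; apply: (eq_by_sub h1 h2); ring.
  - exact: (L2ip_young hO_open hmesh hO_bd).
  - exact: (L2ip_young hO_open hmesh hO_bd).
have S0 i : 0 <= S i.
  apply: Rintegral_ge0 => x _; apply: sumr_ge0 => a _; apply: sumr_ge0 => b _.
  by rewrite -expr2 sqr_ge0.
have grad0 q : 0 <= Rintegral (@leb2 R) O (fun x => \sum_(j < 2) partial j q x ^+ 2).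
  by apply: Rintegral_ge0 => x _; apply: sumr_ge0 => j _; exact: sqr_ge0.
have [km0 _] := hK; have [tm0 _] := hTh.
have KP1 i := Kgrad_coercive hO_open hmesh hO_bd hK (cW _ (hP i)).
have KT1 i := Kgrad_coercive hO_open hmesh hO_bd hTh (cW _ (hQ i)).
have KP0 i : 0 <= KP i := le_trans (mulr_ge0 (ltW km0) (grad0 (P i))) (KP1 i).
have KT0 i : 0 <= KT i := le_trans (mulr_ge0 (ltW tm0) (grad0 (Q i))) (KT1 i).
have [nS [nKP nKT]] := dissipation_nul hlam hmu hdt (fun i => L2ip_ge0 O (X i)) S0 KP0 KT0
  (fun i => proj1 (main i)).
(* Coercivity of [K] passes from the diffusion energy to the gradient, and Poincare's inequality to
   the full H^1 norm. *)
have nP : nul (fun i => H1norm O (P i)).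
  apply: (poincare_nul hO_open hmesh hO_bd hO_conn hGd_sub hGd_pos hP).
  exact: (nul_mul_le km0 (fun i => grad0 (P i)) KP1 nKP).
have nQ : nul (fun i => H1norm O (Q i)).
  apply: (poincare_nul hO_open hmesh hO_bd hO_conn hGd_sub hGd_pos hQ).
  exact: (nul_mul_le tm0 (fun i => grad0 (Q i)) KT1 nKT).
have nXX : nul (fun i => L2ip O (X i) (X i)).
  (* The available bound by [P i] and [Q i] concerns [X i.+1]. *)
  apply: nul_shift.
  exact: (combination_nul halpha hbeta (fun i => L2ip_ge0 O (P i)) (fun i => L2ip_ge0 O (Q i))
    (fun i => L2ip_ge0 O (X i.+1)) PQ0 (L2ip_H1norm_nul nP) (L2ip_H1norm_nul nQ)
    (fun i => proj2 (main i))).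
(* [W], [P] and [Q] begin with the first iterate, and a limit does not depend on the initial term,
   in particular not on the arbitrary [us 0]. *)
split; first exact: (nul_shift (discrete_korn hO_open hmesh hO_bd hO_conn hGd_sub hGd_pos hW nS)).
split; first exact: (nul_sqrt nXX).
by split; [exact: (nul_shift nP)|exact: (nul_shift nQ)].
Qed.
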